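(* It holds that $$\sup_{(\varphi,\xi,z)\in E(\Omega)}\frac{\mathcal B(\tau,\eta,v;\varphi,\xi,z)}{\|(\varphi,\xi,z)\|_{E(\Omega)}}\ge\Big(\frac{\sqrt5-1}{2}\Big)\|(\tau,\eta,v)\|_{E(\Omega)}\qquad\forall(\tau,\eta,v)\in E(\Omega),$$ where the supremum is over triples with nonzero norm.
   Context: $d\in\{2,3\}$, $\Omega\subset\mathbb R^d$ is a bounded polygonal/polyhedral domain with boundary parts $\Gamma_D,\Gamma_N$. $(\cdot,\cdot)$ is the $L^2(\Omega)$ inner product. $[L^2(\Omega)]^{d\times d}_{\rm skw}$ is the space of skew-symmetric $L^2$ tensors, $[H^1_D(\Omega)]^d=\{v\in[H^1(\Omega)]^d:v|_{\Gamma_D}=0\}$, and $E(\Omega)=[L^2(\Omega)]^{d\times d}\times[L^2(\Omega)]^{d\times d}_{\rm skw}\times[H^1_D(\Omega)]^d$. $\varepsilon(v)=\frac12(\nabla v+\nabla v^T)$, $\omega(v)=\frac12(\nabla v-\nabla v^T)$. Lamé parameters $\mu>0$, $\lambda\ge0$. Compliance tensor $\mathcal C\tau=\frac1{2\mu}\big(\tau-\frac{\lambda}{2\mu+d\lambda}\operatorname{tr}(\tau)I\big)$, with inverse the elasticity tensor $\mathcal A\tau=2\mu\tau+\lambda\operatorname{tr}(\tau)I$ (for the plane stress problem, $d=2$, $\lambda$ is replaced by $\lambda^*=2\mu\lambda/(\lambda+2\mu)$ in both). $\|\tau\|_{\mathcal C}^2=(\mathcal C\tau,\tau)$, $\|\tau\|_{\mathcal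 A}^2=(\mathcal A\tau,\tau)$. Bilinear form: $\mathcal B(\sigma,\rho,u;\tau,\eta,v)=(\mathcal C\sigma,\tau)+b(\tau;\rho,u)-b(\sigma;\eta,v)$ with $b(\tau;\eta,v)=(\tau,\eta)-(\tau,\nabla v)$. Energy norm: $\|(\tau,\eta,v)\|_{E(\Omega)}^2=\|\tau\|_{\mathcal C}^2+\|\varepsilon(v)\|_{\mathcal A}^2+\|\eta-\omega(v)\|_{\mathcal A}^2$. *)

(* Defs.v *)
From HB Require Import structures.
From mathcomp Require Import all_boot all_order all_algebra.
From mathcomp Require Import all_classical all_reals all_analysis.

Set Implicit Arguments.
Unset Strict Implicit.
Unset Printing Implicit Defensive.

Import Order.TTheory GRing.Theory Num.Theory.
Import numFieldNormedType.Exports.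

Local Open Scope classical_set_scope.
Local Open Scope ring_scope.

(* Points of R^n are row vectors 'rV[R]_n, with the
   sigma-algebra generated by the coordinates (the Borel sets) and the
   n-fold product of the Lebesgue measure. *)

Section measurable_rV.
Context {d : measure_display} {T : sigmaRingType d}.
Variable n : nat.

Let coors : 'I_n -> 'rV[T]_n -> T := fun i x => x ord0 i.

Let rV_set0 : g_sigma_preimage coors set0.
Proof. exact: sigma_algebra0. Qed.

Let rV_setC A : g_sigma_preimage coors A -> g_sigma_preimage coors (~` A).
Proof. exact: sigma_algebraC. Qed.

Let rV_bigcup (F : _^nat) : (forall i, g_sigma_preimage coors (F i)) ->
  g_sigma_preimage coors (\bigcup_i (F i)).
Proof. exact: sigma_algebra_bigcup. Qed.

HB.instance Definition _ := Pointed.on 'rV[T]_n.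
HB.instance Definition _ := @isMeasurable.Build (measure_tuple_display d)
  'rV[T]_n (g_sigma_preimage coors) rV_set0 rV_setC rV_bigcup.

End measurable_rV.

Lemma measurable_fun_rVP d1 d2 (T1 : measurableType d1) (T2 : measurableType d2)
    n (f : T1 -> 'rV[T2]_n) :
  measurable_fun [set: T1] f <->
  forall i, measurable_fun [set: T1] (fun x => f x ord0 i).
Proof.
apply: (@iff_trans _ (g_sigma_preimage (fun i x => f x ord0 i) `<=` measurable)).
  rewrite (g_sigma_preimage_comp (fun i (x : 'rV[T2]_n) => x ord0 i) f).
  split=> [mf A [/= C preC <-]|prefS]; first exact: mf.
  by move=> _ A mA; apply: prefS; exists A.
split=> [fS i|mf].
- move=> _ A mA; apply: fS; apply: sub_sigma_algebra.
  case: n i => [[] []//|m i] in f *.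
  rewrite -bigcup_mkord_ord; exists i; first exact: ltn_ord.
  by exists A => //; rewrite inord_val.
- apply: smallest_sub; first exact: sigma_algebra_measurable.
  case: n => [|m] in f mf *; first by rewrite big_ord0.
  rewrite -bigcup_mkord_ord; apply: bigcup_sub => i Ii.
  by move=> A [B mB <-]; exact: mf.
Qed.

Lemma measurable_coord d (T : measurableType d) n (i : 'I_n) :
  measurable_fun [set: 'rV[T]_n] (fun x => x ord0 i).
Proof. by move: i; apply/(measurable_fun_rVP (fun x : 'rV[T]_n => x)). Qed.

Section lebesgue.
Context {R : realType}.

Definition consrV n (p : R * 'rV[R]_n) : 'rV[R]_n.+1 :=
  \row_i (if unlift ord0 i is Some j then p.2 ord0 j else p.1).

Definition unconsrV n (x : 'rV[R]_n.+1) : R * 'rV[R]_n :=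
  (x ord0 ord0, \row_j x ord0 (lift ord0 j)).

Lemma consrVK n : cancel (@consrV n) (@unconsrV n).
Proof.
move=> [t x]; rewrite /unconsrV /consrV mxE unlift_none; congr pair.
by apply/rowP => j; rewrite !mxE liftK.
Qed.

Lemma measurable_consrV n : measurable_fun setT (@consrV n).
Proof.
apply/measurable_fun_rVP => i; rewrite /consrV.
under eq_fun do rewrite mxE.
case: unliftP => [j _|_]; last exact: measurable_fst.
exact: (measurableT_comp (measurable_coord j)).
Qed.

Lemma measurable_unconsrV n : measurable_fun setT (@unconsrV n).
Proof.
apply/measurable_fun_pairP; split; first exact: measurable_coord.
apply/measurable_fun_rVP => j; rewrite /unconsrV/=.
under eq_fun do rewrite mxE.
exact: measurable_coord.
Qed.

Section step.
Local Open Scope ereal_scope.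
Variables (n : nat) (m : {sigma_finite_measure set 'rV[R]_n -> \bar R}).

Let lebesgue_prod_sigma_finite : sigma_finite setT (@lebesgue_measure R \x m).
Proof.
have /sigma_finiteP[F [TF ndF Foo]] := sigma_finiteT (@lebesgue_measure R).
have /sigma_finiteP[G [TG ndG Goo]] := sigma_finiteT m.
exists (fun k => F k `*` G k).
  rewrite -setXTT TF TG predeqE => -[x y]; split.
    move=> [/= [k _ Fkx] [l _ Gly]]; exists (maxn k l) => //; split.
    - by move: x Fkx; exact/subsetPset/ndF/leq_maxl.
    - by move: y Gly; exact/subsetPset/ndG/leq_maxr.
  by move=> [k _ []/= ? ?]; split; exists k.
move=> k; have [? ?] := Foo k; have [? ?] := Goo k.
split; first exact: measurableX.
by rewrite product_measure1E// lte_mul_pinfty// ge0_fin_numE.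
Qed.

Definition lebesgue_step : set 'rV[R]_n.+1 -> \bar R :=
  pushforward (@lebesgue_measure R \x m) (@consrV n).

Let step0 : lebesgue_step set0 = 0.
Proof. by rewrite /lebesgue_step /pushforward preimage_set0 measure0. Qed.

Let step_ge0 A : 0 <= lebesgue_step A.
Proof. exact: (measure_ge0 (@lebesgue_measure R \x m)). Qed.

Let step_sigma_additive : semi_sigma_additive lebesgue_step.
Proof.
move=> F mF tF mUF; rewrite /lebesgue_step /pushforward preimage_bigcup.
have mc A : measurable A -> measurable (@consrV n @^-1` A).
  by move=> mA; rewrite -[X in measurable X]setTI; exact: measurable_consrV.
apply: measure_semi_sigma_additive.
- by move=> i; exact: mc.
- apply/trivIsetP => /= i j _ _ ij; rewrite -preimage_setI.
  by move/trivIsetP : tF => /(_ _ _ _ _ ij) ->//; rewrite preimage_set0.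
- by rewrite -preimage_bigcup; exact: mc.
Qed.

HB.instance Definition _ := isMeasure.Build _ _ _ lebesgue_step
  step0 step_ge0 step_sigma_additive.

Let step_sigma_finite : sigma_finite setT lebesgue_step.
Proof.
have [F TF mF] := lebesgue_prod_sigma_finite.
exists (fun k => @unconsrV n @^-1` F k).
  by rewrite -preimage_bigcup -TF preimage_setT.
move=> k; have [mFk Fkoo] := mF k; split.
  by rewrite -[X in measurable X]setTI; exact: measurable_unconsrV.
rewrite /lebesgue_step /pushforward -comp_preimage.
suff -> : @unconsrV n \o @consrV n = id by [].
by apply/funext => p /=; rewrite consrVK.
Qed.

HB.instance Definition _ := Measure_isSigmaFinite.Build _ _ _ lebesgue_step
  step_sigma_finite.

End step.

Fixpoint lebesgue_rV (n : nat) : {sigma_finite_measure set 'rV[R]_n -> \bar R} :=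
  match n with
  | 0 => \d_(0 : 'rV[R]_0)
  | k.+1 => lebesgue_step (lebesgue_rV k)
  end.

End lebesgue.
Arguments lebesgue_rV R n : clear implicits.

Section sobolev.
Context {R : realType} {d : nat}.
Implicit Types (Omega : set 'rV[R]_d) (f g : 'rV[R]_d -> R).

Definition L2 Omega f : Prop := measurable_fun Omega f /\
  (\int[lebesgue_rV R d]_(x in Omega) ((f x) ^+ 2)%:E < +oo)%E.

Definition partial (j : 'I_d) f : 'rV[R]_d -> R := 'D_(delta_mx 0 j) f.

(* C^oo on the whole space: all iterated partial derivatives exist and are
   continuous. *)
Definition smooth f : Prop := forall s : seq 'I_d,
  continuous (foldr partial f s) /\
  forall j x, derivable (foldr partial f s) x (delta_mx 0 j).

Definition test_function Omega f : Prop := smooth f /\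
  exists K : set 'rV[R]_d,
    [/\ compact K, K `<=` Omega & forall x, ~ K x -> f x = 0].

Definition is_weak_partial Omega (j : 'I_d) f g : Prop :=
  forall phi, test_function Omega phi ->
    (\int[lebesgue_rV R d]_(x in Omega) (f x * partial j phi x) =
     - \int[lebesgue_rV R d]_(x in Omega) (g x * phi x))%R.

Definition H1 Omega f : Prop := L2 Omega f /\
  forall j, exists2 g, L2 Omega g & is_weak_partial Omega j f g.

(* A chosen representative; it is determined a.e. on Omega for f in H1. *)
Definition weak_partial Omega (j : 'I_d) f : 'rV[R]_d -> R :=
  get [set g | L2 Omega g /\ is_weak_partial Omega j f g].

(* (grad v)_ij = d_j v_i *)
Definition weak_grad Omega (v : 'rV[R]_d -> 'rV[R]_d) (x : 'rV[R]_d) : 'M[R]_d :=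
  \matrix_(i, j) weak_partial Omega j (fun y => v y 0 i) x.

End sobolev.

Section polyhedral.
Context {R : realType} {d : nat}.

Definition simplex (p : 'I_d.+1 -> 'rV[R]_d) : set 'rV[R]_d :=
  [set x | exists t : 'I_d.+1 -> R,
    [/\ forall i, 0 <= t i, \sum_i t i = 1 & x = \sum_i t i *: p i]].

Definition nondegenerate (p : 'I_d.+1 -> 'rV[R]_d) : Prop :=
  \matrix_(i < d) (p (lift ord0 i) - p ord0) \in unitmx.

(* A (necessarily bounded) polygonal/polyhedral domain, presented by a
   subdivision T of its closure into simplices with disjoint interiors; T need
   not be conforming, and Omega need not be Lipschitz. *)
Definition polyhedral_domain m (T : 'I_m -> 'I_d.+1 -> 'rV[R]_d)
    (Omega : set 'rV[R]_d) : Prop :=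
  [/\ forall k, nondegenerate (T k),
      forall k l, k != l ->
        interior (simplex (T k)) `&` interior (simplex (T l)) = set0,
      Omega = interior (\bigcup_k simplex (T k)),
      Omega !=set0 & connected Omega].

Definition bdry (Omega : set 'rV[R]_d) := closure Omega `\` interior Omega.

(* Vertices number 0, ..., d-1 of the facet of the simplex p opposite to p i *)
Definition facet_vertex (p : 'I_d.+1 -> 'rV[R]_d) (i : 'I_d.+1) (l : nat) :=
  p (inord (bump i l)).

Definition facet_edges (p : 'I_d.+1 -> 'rV[R]_d) (i : 'I_d.+1) : 'M[R]_(d.-1, d) :=
  \matrix_(l < d.-1) (facet_vertex p i l.+1 - facet_vertex p i 0).

Definition facet_param p i (u : 'rV[R]_d.-1) : 'rV[R]_d :=
  facet_vertex p i 0 + u *m facet_edges p i.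

Definition unit_simplex n : set 'rV[R]_n :=
  [set u | (forall j, 0 <= u 0 j) /\ \sum_j u 0 j <= 1].
Arguments unit_simplex n : clear implicits.

(* Integral over A with respect to the (d-1)-dimensional surface measure, for
   A contained in the boundary of the domain subdivided by T. Almost every
   boundary point lies on exactly one facet of exactly one simplex of T, so
   that nothing is counted twice. *)
Definition surface_integral m (T : 'I_m -> 'I_d.+1 -> 'rV[R]_d)
    (A : set 'rV[R]_d) (f : 'rV[R]_d -> R) : \bar R :=
  (\sum_(k < m) \sum_(i < d.+1)
    (Num.sqrt (\det (facet_edges (T k) i *m (facet_edges (T k) i)^T)))%:E *
    \int[lebesgue_rV R d.-1]_(u in unit_simplex d.-1 `&` (facet_param (T k) i @^-1` A))
       (f (facet_param (T k) i u))%:E)%E.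

Definition boundary_parts m (T : 'I_m -> 'I_d.+1 -> 'rV[R]_d)
    (Omega GammaD GammaN : set 'rV[R]_d) : Prop :=
  [/\ measurable GammaD /\ measurable GammaN,
      GammaD `<=` bdry Omega /\ GammaN `<=` bdry Omega,
      GammaD `&` GammaN = set0 &
      surface_integral T (bdry Omega `\` (GammaD `|` GammaN)) (fun=> 1) = 0%E].

(* g is the trace of f on the boundary: the trace operator is the continuous
   extension to H1 of the restriction to the boundary of functions that are
   smooth up to the boundary. *)
Definition is_trace m (T : 'I_m -> 'I_d.+1 -> 'rV[R]_d) (Omega : set 'rV[R]_d)
    (f g : 'rV[R]_d -> R) : Prop :=
  measurable_fun setT g /\
  exists phi : nat -> 'rV[R]_d -> R,
    [/\ forall n, smooth (phi n),
        (\int[lebesgue_rV R d]_(x in Omega) ((phi n x - f x) ^+ 2)%:E)%E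
          @[n --> \oo] --> 0%E,
        forall j, (\int[lebesgue_rV R d]_(x in Omega)
            ((partial j (phi n) x - weak_partial Omega j f x) ^+ 2)%:E)%E
          @[n --> \oo] --> 0%E &
        surface_integral T (bdry Omega) (fun x => (phi n x - g x) ^+ 2)
          @[n --> \oo] --> 0%E].

Definition H1D m (T : 'I_m -> 'I_d.+1 -> 'rV[R]_d) (Omega GammaD : set 'rV[R]_d)
    (v : 'rV[R]_d -> 'rV[R]_d) : Prop :=
  forall i : 'I_d, H1 Omega (fun x => v x 0 i) /\
    exists2 g, is_trace T Omega (fun x => v x 0 i) g &
      surface_integral T GammaD (fun x => (g x) ^+ 2) = 0%E.

End polyhedral.

Section elasticity.
Context {R : realType} {d : nat}.
Implicit Types (Omega : set 'rV[R]_d) (sigma tau eta : 'rV[R]_d -> 'M[R]_d).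
Implicit Types (v : 'rV[R]_d -> 'rV[R]_d) (mu lambda : R).

Definition L2_tensor Omega tau : Prop := forall i j, L2 Omega (fun x => tau x i j).

Definition L2_skw Omega eta : Prop := L2_tensor Omega eta /\
  {ae lebesgue_rV R d, forall x, Omega x -> (eta x)^T = - eta x}.

Definition inner Omega sigma tau : R :=
  (\int[lebesgue_rV R d]_(x in Omega) \sum_i \sum_j sigma x i j * tau x i j)%R.

Definition strain Omega v (x : 'rV[R]_d) : 'M[R]_d :=
  2^-1 *: (weak_grad Omega v x + (weak_grad Omega v x)^T).

Definition rotation Omega v (x : 'rV[R]_d) : 'M[R]_d :=
  2^-1 *: (weak_grad Omega v x - (weak_grad Omega v x)^T).

(* The first Lame parameter entering both tensors *)
Definition lame_lambda (plane_stress : bool) mu lambda : R :=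
  if plane_stress then 2 * mu * lambda / (lambda + 2 * mu) else lambda.

Definition compliance mu lambda (t : 'M[R]_d) : 'M[R]_d :=
  (2 * mu)^-1 *: (t - (lambda / (2 * mu + d%:R * lambda) * \tr t)%:M).

Definition elasticity mu lambda (t : 'M[R]_d) : 'M[R]_d :=
  (2 * mu) *: t + (lambda * \tr t)%:M.

Definition normC2 Omega mu lambda tau : R :=
  inner Omega (compliance mu lambda \o tau) tau.

Definition normA2 Omega mu lambda tau : R :=
  inner Omega (elasticity mu lambda \o tau) tau.

Record triple := Triple {
  stress : 'rV[R]_d -> 'M[R]_d;
  rot : 'rV[R]_d -> 'M[R]_d;
  disp : 'rV[R]_d -> 'rV[R]_d }.

Definition energy_space m (T : 'I_m -> 'I_d.+1 -> 'rV[R]_d)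
    Omega GammaD (s : triple) : Prop :=
  [/\ L2_tensor Omega (stress s), L2_skw Omega (rot s) &
      H1D T Omega GammaD (disp s)].

Definition bform Omega tau eta v : R :=
  inner Omega tau eta - inner Omega tau (weak_grad Omega v).

Definition Bform Omega mu lambda (s t : triple) : R :=
  inner Omega (compliance mu lambda \o stress s) (stress t)
  + bform Omega (stress t) (rot s) (disp s)
  - bform Omega (stress s) (rot t) (disp t).

Definition energy_norm Omega mu lambda (s : triple) : R :=
  Num.sqrt (normC2 Omega mu lambda (stress s)
    + normA2 Omega mu lambda (strain Omega (disp s))
    + normA2 Omega mu lambda (fun x => rot s x - rotation Omega (disp s) x)).

End elasticity.
Arguments triple R d : clear implicits.

(* Main.v *)
(** With G = eta - grad v, the pointwise orthogonality of symmetric and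
    skew-symmetric tensors turns the energy norm into ||tau||_C^2 + ||G||_A^2,
    and B(s; t) = (C tau, phi) + (phi, G) - (tau, G_t). Testing with
    t = (tau + A G, - k eta, - k v), where k = (tau, G) / ||G||_A^2, makes
    B(s; t) equal to the square of the norm of t, namely
      ||tau||_C^2 + 2 (tau, G) + ||G||_A^2 + k^2 ||G||_A^2,
    and Cauchy-Schwarz bounds this below by c^2 (||tau||_C^2 + ||G||_A^2), where
    c (1 + c) = 1. That t has the expected gap - k G rests on the uniqueness of
    weak derivatives (du Bois-Reymond). If t has norm 0, then so has s, and any
    stress of nonzero norm will do up to sign. *)

Require Import Defs.
From HB Require Import structures.
From mathcomp Require Import all_boot all_order all_algebra.
From mathcomp Require Import all_classical all_reals all_analysis.
From mathcomp Require Import measurable_realfun ring lra.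

Set Implicit Arguments.
Unset Strict Implicit.
Unset Printing Implicit Defensive.

Import Order.TTheory GRing.Theory Num.Theory.
Import numFieldNormedType.Exports.

Local Open Scope classical_set_scope.
Local Open Scope ring_scope.

(** * Boxes and Borel sets *)

Section boxes.
Context {R : realType}.
Implicit Types n : nat.

(** The test triple is a projected Riesz representer. In terms of stress and gap, B(s; .) is
    represented, for the inner products given by C and A, by the pair (tau + A G, - C tau). But C
    tau need not be the gap of an admissible triple, so it is replaced by its A-orthogonal
    projection on the line through G; this is k G, because (A C tau, G) = (tau, G). Hence B(s; t) is
    the square of the norm of t. Moreover the rotation and the displacement of t are multiples of
    those of s, so that homogeneity of weak derivatives and traces suffices.

    Origin of the constant: Cauchy-Schwarz says k^2 ||G||_A^2 <= ||tau||_C^2. In the equality case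
    tau = k A G, the square of the norm of t is (2 k^2 + 2 k + 1) ||G||_A^2, that of s is (k^2 + 1)
    ||G||_A^2, and 2 k^2 + 2 k + 1 is the quadratic form of the matrix with rows (2, 1) and (1, 1)
    at (k, 1). Its least eigenvalue is (3 - sqrt 5) / 2 = c^2. *)

Definition box n (a b : 'rV[R]_n) : set 'rV[R]_n :=
  [set x | forall i, a 0 i < x 0 i < b 0 i].
Definition cbox n (a b : 'rV[R]_n) : set 'rV[R]_n :=
  [set x | forall i, a 0 i <= x 0 i <= b 0 i].

Lemma boxE n (a b : 'rV[R]_n) :
  box a b = \bigcap_i ((fun x : 'rV[R]_n => x 0 i) @^-1` `]a 0 i, b 0 i[%classic).
Proof.
apply/seteqP; split => x /=; rewrite /box/=.
  by move=> h i _ /=; rewrite in_itv/=.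
by move=> h i; have := h i Logic.I; rewrite /= in_itv.
Qed.

Lemma measurable_box n (a b : 'rV[R]_n) : measurable (box a b).
Proof.
rewrite boxE; apply: fin_bigcap_measurable => // i _.
by rewrite -[X in measurable X]setTI; exact: measurable_coord.
Qed.

(** The measure is built recursively as the image of a product under [consrV], so peeling off the
    first coordinate turns a box into a rectangle. The truncation at 0 accounts for empty boxes. *)
Lemma lebesgue_rV_box n (a b : 'rV[R]_n) :
  lebesgue_rV R n (box a b) = (\prod_i Num.max 0 (b 0 i - a 0 i))%:E.
Proof.
elim: n a b => [|n IH] a b.
  rewrite big_ord0 /= diracE mem_set// => -[] //.
rewrite big_ord_recl /=.
rewrite /lebesgue_step /pushforward.
have -> : @consrV R n @^-1` box a b =
    `]a 0 ord0, b 0 ord0[%classic `*`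
    box (\row_j a 0 (lift ord0 j)) (\row_j b 0 (lift ord0 j)).
  apply/seteqP; split => -[t x] /=; rewrite /box/= in_itv/=.
    move=> h; split; first by have := h ord0; rewrite mxE unlift_none.
    by move=> i; have := h (lift ord0 i); rewrite !mxE liftK.
  move=> [h0 h] i; rewrite mxE; case: unliftP => [j ->|->] //.
  by have := h j; rewrite !mxE.
rewrite product_measure1E//; last exact: measurable_box.
rewrite IH EFinM; congr (_ * _)%E; last first.
  by congr _%:E; apply: eq_bigr => i _; rewrite !mxE.
transitivity (if a 0 ord0 < b 0 ord0 then b 0 ord0 - a 0 ord0 else 0)%:E.
  apply: etrans (lebesgue_measure_itv `]a 0 ord0, b 0 ord0[) _.
  by rewrite /= lte_fin; case: ifP.
congr _%:E; case: ltP => h; rewrite /Num.max subr_gt0; first by rewrite h.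
by rewrite ltNge h.
Qed.

Lemma bigcup_box_coord n (i : 'I_n) (x y : R) :
  (fun v : 'rV[R]_n => v 0 i) @^-1` `]x, y[%classic =
  \bigcup_k box (\row_j if j == i then x else - k%:R)
                (\row_j if j == i then y else k%:R).
Proof.
apply/seteqP; split => v /=.
  rewrite in_itv/= => h.
  exists (Num.truncn (\sum_j `|v 0 j|)).+1 => //= j; rewrite !mxE.
  case: eqP => [->//|_]; rewrite -ltr_norml.
  apply: le_lt_trans (truncnS_gt _).
  by rewrite (bigD1 j)//= lerDl sumr_ge0.
by move=> [k _ /(_ i)]; rewrite !mxE eqxx in_itv.
Qed.

(** Boxes are stable under intersection, so this generator makes the Dynkin argument of [ae_box0]
    possible. A coordinate preimage of an interval is a slab, which growing boxes exhaust. *)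
Lemma measurable_rV_gen_box n :
  @measurable _ 'rV[R]_n = <<s [set A | exists a b : 'rV[R]_n, A = box a b] >>.
Proof.
set G := [set A | _].
apply/seteqP; split; last first.
  apply: smallest_sub; first exact: sigma_algebra_measurable.
  by move=> _ [a [b ->]]; exact: measurable_box.
rewrite /measurable /=.
case: n @G => [|n] G.
  apply: smallest_sub; first exact: smallest_sigma_algebra.
  by rewrite big_ord0 => ? [].
apply: smallest_sub; first exact: smallest_sigma_algebra.
rewrite -bigcup_mkord_ord; apply: bigcup_sub => i /= ltin _ [B mB <-].
rewrite setTI; set k := inord i.
have mi : @measurable _ (measurableTypeR R) = <<s (@RGenOpens.G R) >>.
  exact: RGenOpens.measurableE.
have {mB} : <<s (@RGenOpens.G R) >> B by rewrite -mi.
suff : <<s (@RGenOpens.G R) >> `<=`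
    [set B | <<s G >> ((fun v : 'rV[R]_n.+1 => v 0 k) @^-1` B)] by apply.
apply: smallest_sub.
  split => /=.
  - by rewrite preimage_set0; exact: sigma_algebra0.
  - move=> A hA; rewrite setTD preimage_setC -setTD.
    exact: sigma_algebraCD.
  - by move=> F hF; rewrite preimage_bigcup; exact: sigma_algebra_bigcup.
move=> _ [x [y ->]] /=; rewrite bigcup_box_coord.
apply: sigma_algebra_bigcup => j; apply: sub_sigma_algebra.
by eexists; eexists.
Qed.

(** An enumeration of the boxes with rational corners. A number that encodes no pair of corners gets
    the default pair (0, 0), which is again a pair of rational corners and hence harmless. *)
Definition rat_box n (k : nat) : 'rV[R]_n * 'rV[R]_n :=
  let p := odflt 0 (unpickle k : option ('rV[rat]_n * 'rV[rat]_n)) in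
  (map_mx ratr p.1, map_mx ratr p.2).

(** The condition bears on the closed box, so that each open box of this countable union has a
    compact hull inside [U] and thus carries test functions. *)
Lemma open_bigcup_box n (U : set 'rV[R]_n) : open U ->
  U = \bigcup_(k in [set k | cbox (rat_box n k).1 (rat_box n k).2 `<=` U])
        box (rat_box n k).1 (rat_box n k).2.
Proof.
move=> oU; apply/seteqP; split => x; last first.
  move=> [k /= kU xk]; apply: kU => i.
  by have /andP[h1 h2] := xk i; rewrite !ltW.
move=> Ux; have /nbhs_ballP[e /= e0 xeU] := oU _ Ux.
have ha (i : 'I_n) : {q : rat | x 0 i - e < ratr q < x 0 i}.
  apply: cid; have [|q] := @rat_in_itvoo _ (x 0 i - e) (x 0 i).
    by rewrite ltrBlDr ltrDl.
  by rewrite in_itv/=; exists q.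
have hb (i : 'I_n) : {q : rat | x 0 i < ratr q < x 0 i + e}.
  apply: cid; have [|q] := @rat_in_itvoo _ (x 0 i) (x 0 i + e).
    by rewrite ltrDl.
  by rewrite in_itv/=; exists q.
pose p := (\row_i sval (ha i), \row_i sval (hb i)) : 'rV[rat]_n * 'rV[rat]_n.
exists (pickle p); rewrite /= /rat_box pickleK/=.
  move=> y hy; apply: xeU; split=> // i j; rewrite ord1 /ball/=.
  have := hy j; rewrite !mxE.
  case: (ha j) => q /=; case: (hb j) => q' /= /andP[h1 h2] /andP[h3 h4] /andP[h5 h6].
  rewrite ltr_distlC; apply/andP; split.
    exact: lt_le_trans h5.
  exact: le_lt_trans h2.
move=> i /=; rewrite !mxE.
by case: (ha i) => q /=; case: (hb i) => q' /= /andP[-> _] /andP[_ ->].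
Qed.

Lemma open_measurable_rV n (U : set 'rV[R]_n) : open U -> measurable U.
Proof.
move=> /open_bigcup_box ->; apply: bigcup_measurable => k _.
exact: measurable_box.
Qed.

Lemma closed_measurable_rV n (U : set 'rV[R]_n) : closed U -> measurable U.
Proof.
by move=> /closed_openC/open_measurable_rV/measurableC; rewrite setCK.
Qed.

Lemma continuous_measurable_rV n (f : 'rV[R]_n -> R) : continuous f ->
  measurable_fun setT f.
Proof.
move=> cf; apply: (measurability _ (RGenOpens.measurableE R)).
move=> _ [_ [x [y ->]] <-]; rewrite setTI; apply: open_measurable_rV.
by move/continuousP : cf; apply; exact: interval_open.
Qed.

Lemma compact_cbox n (a b : 'rV[R]_n) : compact (cbox a b).
Proof.
have -> : cbox a b = [set v | forall i, `[a 0 i, b 0 i]%classic (v 0 i)].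
  by apply/seteqP; split => x /= h i; have := h i; rewrite in_itv.
apply: (@rV_compact R n (fun i => `[a 0 i, b 0 i]%classic)) => i.
exact: segment_compact.
Qed.

Lemma compact_sub_box n (K : set 'rV[R]_n) : compact K ->
  exists a b, K `<=` box a b.
Proof.
move=> /compact_bounded[M [Mr MK]].
(* Every number above [M] bounds the norm on [K]: [M + 1] is such a number, and [M + 2] makes the
   inequality strict. *)
exists (const_mx (- (M + 2))), (const_mx (M + 2)) => x Kx i; rewrite !mxE -ltr_norml.
have /= := MK (M + 1) _ x Kx; rewrite ltrDl ltr01 => /(_ isT) h.
apply: (@le_lt_trans _ _ (M + 1)); last by rewrite ltrD2l ltr1n.
apply: le_trans h.
by rewrite -[leRHS]/(mx_norm x) mx_normrE; exact: (le_bigmax _ (fun ij : 'I_1 * 'I_n => `|x ij.1 ij.2|) (0, i)).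
Qed.

Lemma lebesgue_rV_compact n (K : set 'rV[R]_n) : compact K ->
  (lebesgue_rV R n K < +oo)%E.
Proof.
move=> cK; have [a [b Kab]] := compact_sub_box cK.
apply: (@le_lt_trans _ _ (lebesgue_rV R n (box a b))).
  apply: le_measure => //; rewrite inE; last exact: measurable_box.
  by apply: closed_measurable_rV; apply: compact_closed => //; exact: norm_hausdorff.
by rewrite lebesgue_rV_box ltry.
Qed.
End boxes.

(** * Smooth bump functions *)

Section flat.
Context {R : realType}.

(** Termwise, u^i <= i! exp u by the exponential series. It is applied at u = 1 / t. *)
Lemma horner_le_expR (p : {poly R}) : exists2 C, 0 <= C &
  forall u, 0 <= u -> `|p.[u]| <= C * expR u.
Proof.
exists (\sum_(i < size p) `|p`_i| * i`!%:R) => [|u u0].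
  by apply: sumr_ge0 => i _; rewrite mulr_ge0.
rewrite horner_coef mulr_suml; apply: (le_trans (ler_norm_sum _ _ _)).
apply: ler_sum => i _; rewrite normrM -mulrA ler_wpM2l// ger0_norm ?exprn_ge0//.
case: (nat_of_ord i) => [|k].
  by rewrite expr0 fact0 mul1r -expR0 ler_expR.
rewrite mulrC -ler_pdivrMr ?ltr0n ?fact_gt0//.
by apply: le_trans (expR_ge1Dxn k u0); rewrite lerDr.
Qed.

(* A class of functions closed under derivation, whatever the polynomial; the
   case p = 1 is the classical smooth function that is flat at 0. *)
Definition flat (p : {poly R}) (t : R) : R :=
  if 0 < t then p.[t^-1] * expR (- t^-1) else 0.

(** Applying the previous bound to p X^2 at 1 / t gains the factor t^2 once the exponential cancels.
    A quadratic bound forces the difference quotient at 0 to vanish. *)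
Lemma flat_le_sqr p : exists2 C, 0 <= C & forall t, `|flat p t| <= C * t ^+ 2.
Proof.
have [C C0 hC] := horner_le_expR (p * 'X^2).
exists C => // t; rewrite /flat; case: ifPn => [t0|_]; last first.
  by rewrite normr0 mulr_ge0// sqr_ge0.
have := hC t^-1; rewrite invr_ge0 ltW// => /(_ isT).
rewrite hornerM hornerXn normrM [X in _ * X]ger0_norm ?sqr_ge0// => h.
rewrite normrM [X in _ * X]ger0_norm ?expR_ge0// expRN ler_pdivrMr ?expR_gt0//.
have t2 : t ^+ 2 * t^-1 ^+ 2 = 1 by rewrite -exprMn mulfV ?gt_eqF// expr1n.
rewrite -[leLHS]mulr1 -t2 [t ^+ 2 * _]mulrC mulrA [C * _ * _]mulrAC.
by rewrite ler_wpM2r ?sqr_ge0.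
Qed.

(** The factor X^2 comes from the derivative - t^-2 of 1 / t, and p - p' from the product rule. At 0
    the derivative is 0 by [flat_le_sqr]. *)
Lemma flat_derivable p t :
  is_derive t (1 : R) (flat p) (flat ('X^2 * (p - p^`())) t).
Proof.
have [t0|t0|->] := ltgtP t 0.
- rewrite {2}/flat ltNge ltW//=.
  have e : \forall x \near t, cst 0 x = flat p x.
    near=> x; rewrite /flat ltNge ltW//=; near: x.
    exact: lt_nbhsl.
  split; first by apply: (@near_eq_derivable _ _ _ (cst 0) (flat p)) => //; exact: derivable_cst.
  by rewrite -(@near_eq_derive _ _ _ (cst 0) (flat p) _ _ e) derive_cst.
- rewrite {2}/flat t0.
  have e : \forall x \near t, ((horner p \o (fun y : R => y^-1)) * (expR \o (fun y : R => - y^-1))) x = flat p x.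
    near=> x; rewrite /flat ifT//; near: x.
    by have := @Nlt_nbhsl _ t 0; rewrite oppr_lt0 => /(_ t0); apply: filterS => y; rewrite oppr_lt0.
  have dV : is_derive t (1 : R) (fun y : R => y^-1) (- t ^- 2 *: 1).
    by apply: is_deriveV; rewrite ?gt_eqF//; exact: is_derive_id.
  have dN : is_derive t (1 : R) (fun y : R => - y^-1) (- (- t ^- 2 *: 1)).
    exact: is_deriveN.
  have d1 := is_derive1_comp (is_derive_poly p t^-1) dV.
  have d2 := @is_derive1_comp _ expR (fun y : R => - y^-1) _ _ _ (is_derive_expR (- t^-1)) dN.
  have [h1 h2] := is_deriveM d1 d2.
  split; first exact: (@near_eq_derivable _ _ _ _ (flat p) _ _ e).
  rewrite -(@near_eq_derive _ _ _ _ (flat p) _ _ e) h2 /= !hornerE /= /GRing.scale/= -exprVn; ring.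
- have [C C0 hC] := flat_le_sqr p.
  rewrite {2}/flat ltxx.
  have c0 : h^-1 *: ((flat p \o shift 0) (h *: 1) - flat p 0) @[h --> (0:R)^'] --> (0 : R).
    apply/cvgr0Pnorm_le => e e0; near=> h.
    have h0 : h != 0 by near: h; exact: nbhs_dnbhs_neq.
    rewrite /= {2}/flat ltxx subr0 addr0 /GRing.scale/= mulr1 normrM normfV.
    rewrite mulrC ler_pdivrMr ?normr_gt0//.
    apply: (le_trans (hC _)); rewrite -[h ^+ 2]ger0_norm ?sqr_ge0//.
    rewrite normrX expr2 mulrA ler_wpM2r//.
    (* The constant [C] may be 0, hence the denominator [C + 1]. *)
    have hb : `|h| <= e / (C + 1).
      near: h; apply: dnbhs0_le; rewrite divr_gt0// ltr_pwDr//.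
    apply: (@le_trans _ _ ((C + 1) * (e / (C + 1)))).
      by apply: ler_pM => //; rewrite lerDl.
    by rewrite mulrC divfK// gt_eqF// ltr_pwDr.
  split; first by apply/cvg_ex; exists 0.
  exact: (cvg_lim _ c0).
Unshelve. all: by end_near. Qed.

Lemma flat_ge0 t : 0 <= flat 1 t.
Proof. by rewrite /flat; case: ifP => // _; rewrite hornerC mul1r expR_ge0. Qed.

Lemma flat_le1 t : flat 1 t <= 1.
Proof.
rewrite /flat; case: ifP => // t0; rewrite hornerC mul1r -expR0 ler_expR.
by rewrite oppr_le0 invr_ge0 ltW.
Qed.

Lemma flat_eq0 t : t <= 0 -> flat 1 t = 0.
Proof. by rewrite /flat ltNge => ->. Qed.

Lemma flat_cvg1 t : 0 < t -> flat 1 (n.+1%:R * t) @[n --> \oo] --> (1 : R).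
Proof.
move=> t0.
have -> : (fun n => flat 1 (n.+1%:R * t)) = (fun n => expR (- (n.+1%:R^-1 * t^-1))).
  by apply/funext => n; rewrite /flat mulr_gt0// hornerC mul1r invfM.
rewrite -[X in _ --> X]expR0 -oppr0 -[X in - X](mul0r t^-1).
apply: continuous_cvg; first exact: continuous_expR.
apply: cvgN; apply: cvgMl.
exact: cvg_harmonic.
Qed.
End flat.

Section smoothness.
Context {R : realType} {d : nat}.
Implicit Types f g : 'rV[R]_d -> R.

(** [smooth] speaks of iterated partial derivatives of one function and does not pass through the
    product rule, which yields several functions of lower order. Recursion on the order does;
    [smoothP] relates the two. *)
Fixpoint Ck k f : Prop :=
  if k is k'.+1 then continuous f /\
    forall j, (forall x, derivable f x (delta_mx 0 j)) /\ Ck k' (partial j f)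
  else continuous f.

Lemma CkW k f : Ck k.+1 f -> Ck k f.
Proof.
elim: k f => [|k IH] f [cf hf] //; split=> // j.
by have [h1 h2] := hf j; split => //; exact: IH.
Qed.

Lemma CkD k f g : Ck k f -> Ck k g -> Ck k (f + g).
Proof.
elim: k f g => [|k IH] f g.
  by move=> cf cg x; exact: (continuousD (cf x) (cg x)).
move=> [cf hf] [cg hg]; split=> [x|j]; first exact: continuousD (cf x) (cg x).
have [f1 f2] := hf j; have [g1 g2] := hg j; split=> [x|].
  exact: derivableD.
suff -> : partial j (f + g) = partial j f + partial j g by exact: IH.
by apply/funext => x; rewrite /partial deriveD.
Qed.

Lemma CkM k f g : Ck k f -> Ck k g -> Ck k (f * g).
Proof.
elim: k f g => [|k IH] f g.
  by move=> cf cg x; exact: (continuousM (cf x) (cg x)).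
move=> hf' hg'; have [cf hf] := hf'; have [cg hg] := hg'.
split=> [x|j]; first exact: continuousM (cf x) (cg x).
have [f1 f2] := hf j; have [g1 g2] := hg j; split=> [x|].
  exact: derivableM.
suff -> : partial j (f * g) = f * partial j g + g * partial j f.
  by apply: CkD; apply: IH => //; exact: CkW.
by apply/funext => x; rewrite /partial deriveM.
Qed.

Lemma Ck_cst k (c : R) : Ck k (cst c).
Proof.
elim: k c => [|k IH] c; first exact: cst_continuous.
split=> [|j]; first exact: cst_continuous.
split=> [x|]; first exact: derivable_cst.
suff -> : partial j (cst c : 'rV[R]_d -> R) = cst 0 by exact: IH.
by apply/funext => x; rewrite /partial derive_cst.
Qed.

Lemma Ck_prod k (I : Type) (r : seq I) (F : I -> 'rV[R]_d -> R) :
  (forall i, Ck k (F i)) -> Ck k (\prod_(i <- r) F i).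
Proof.
move=> h; elim/big_ind : _ => //; [exact: Ck_cst|exact: CkM].
Qed.

(** Along the line through x in direction v the function is [g] after an affine map, so the
    one-variable chain rule gives the directional derivative. *)
Lemma derive_line (f : 'rV[R]_d -> R) x v (g : R -> R) c b dg :
  (forall h, f (h *: v + x) = g (c * h + b)) -> is_derive b 1 g dg ->
  is_derive x v f (c * dg).
Proof.
move=> fg hg.
have hL : is_derive (0 : R) 1 (fun h : R => c * h + b) c.
  have := @is_deriveD _ _ _ (c \*: id) (cst b) (0 : R) 1 (c *: 1) 0 (is_deriveZ _ (is_derive_id _ _)) (is_derive_cst _ _ _).
  by rewrite addr0 /GRing.scale/= mulr1.
have hg0 : is_derive (c * 0 + b) 1 g dg by rewrite mulr0 add0r.
have [k1 k2] := @is_derive1_comp _ g (fun h : R => c * h + b) 0 _ _ hg0 hL.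
have e : (fun h : R => h^-1 *: ((f \o shift x) (h *: v) - f x)) =
    (fun h : R => h^-1 *: (((g \o (fun h : R => c * h + b)) \o shift 0) (h *: 1) - (g \o (fun h : R => c * h + b)) 0)).
  apply/funext => h /=; rewrite fg addr0 /GRing.scale/= mulr1.
  by have := fg 0; rewrite scale0r add0r => ->.
split; first by rewrite /derivable e.
by rewrite /derive e -[RHS]mulrC -k2.
Qed.

Lemma Ck_flat k (p : {poly R}) (i : 'I_d) (a b : R) :
  Ck k (fun x => flat p (a * x 0 i + b)).
Proof.
have hd (q : {poly R}) (j : 'I_d) (x : 'rV[R]_d) : is_derive x (delta_mx 0 j)
    (fun x : 'rV[R]_d => flat q (a * x 0 i + b))
    ((a * (i == j)%:R) * flat ('X^2 * (q - q^`())) (a * x 0 i + b)).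
  apply: (derive_line (g := flat q) (b := a * x 0 i + b)).
    by move=> h; rewrite !mxE eqxx/=; congr flat; rewrite mulrDr addrA; congr (_ + _ + _); rewrite [RHS]mulrAC mulrA.
  exact: flat_derivable.
have hc (q : {poly R}) : continuous (fun x : 'rV[R]_d => flat q (a * x 0 i + b)).
  move=> x; apply: (@continuous_comp _ _ _ (fun x : 'rV[R]_d => a * x 0 i + b) (flat q)).
    exact: (@continuousD _ _ _ (fun x : 'rV[R]_d => a * x 0 i) (cst b) x
      (@continuousM _ _ (cst a) (fun x : 'rV[R]_d => x 0 i) x (@cst_continuous _ _ a x) (@coord_continuous _ _ _ 0 i x)) (@cst_continuous _ _ b x)).
  apply: differentiable_continuous; apply/derivable1_diffP.
  by have [] := flat_derivable q (a * x 0 i + b).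
(* The induction is over all polynomials at once, since each derivative replaces [p] by another
   one. *)
elim: k p => [|k IH] p; first exact: hc.
split=> [|j]; first exact: hc.
split=> [x|]; first by have [] := hd p j x.
have -> : partial j (fun x : 'rV[R]_d => flat p (a * x 0 i + b)) =
    cst (a * (i == j)%:R) * (fun x : 'rV[R]_d => flat ('X^2 * (p - p^`())) (a * x 0 i + b)).
  by apply/funext => x; rewrite /partial; have [_ ->] := hd p j x.
by apply: CkM; [exact: Ck_cst|exact: IH].
Qed.

Lemma smoothP f : smooth f <-> forall k, Ck k f.
Proof.
split=> [sf k|h s].
  elim: k f sf => [|k IH] f sf; first by have [] := sf [::].
  split=> [|j]; first by have [] := sf [::].
  split=> [x|]; first by have [_] := sf [::]; exact.
  by apply: IH => s; rewrite -foldr_rcons; exact: sf.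
suff H k : Ck k (foldr partial f s).
  by split=> [|j x]; [exact: (H 0%N)|have [_ /(_ j)[]] := H 1%N].
elim: s k => [|j s IH] k //=.
by have [_ /(_ j)[]] := IH k.+1.
Qed.

Lemma smooth_continuous f : smooth f -> continuous f.
Proof. by move=> /(_ [::])[]. Qed.

Lemma smooth_partial f j : smooth f -> smooth (partial j f).
Proof. by move=> sf s; rewrite -foldr_rcons; exact: sf. Qed.

Lemma smooth_scale (c : R) f : smooth f -> smooth (fun x => c * f x).
Proof.
by move=> /smoothP sf; apply/smoothP => k; apply: (CkM (Ck_cst k c)).
Qed.

Lemma partial_scale (c : R) f j x : smooth f ->
  partial j (fun y => c * f y) x = c * partial j f x.
Proof.
move=> sf; have df : derivable f x (delta_mx 0 j) by have [_] := sf [::]; exact.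
rewrite /partial -[X in 'D__ X _]/(cst c * f) deriveM//.
by rewrite derive_cst scaler0 addr0.
Qed.

(* Since exp (- 1 / (n t)) = exp (- 1 / t) ^ (1 / n), these functions tend to
   the indicator of the box, whence no cut-off or mollifier is needed. *)
Definition box_bump (a b : 'rV[R]_d) (n : nat) : 'rV[R]_d -> R :=
  \prod_i ((fun x : 'rV[R]_d => flat 1 (n.+1%:R * x 0 i + - (n.+1%:R * a 0 i))) *
           (fun x : 'rV[R]_d => flat 1 (- n.+1%:R * x 0 i + n.+1%:R * b 0 i))).

Lemma box_bumpE a b n x : box_bump a b n x =
  \prod_i (flat 1 (n.+1%:R * (x 0 i - a 0 i)) * flat 1 (n.+1%:R * (b 0 i - x 0 i))).
Proof.
rewrite /box_bump fct_prodE; apply: eq_bigr => i _.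
by congr (flat _ _ * flat _ _); rewrite mulrBr// mulNr addrC.
Qed.

Lemma smooth_box_bump a b n : smooth (box_bump a b n).
Proof.
by apply/smoothP => k; apply: Ck_prod => i; apply: CkM; exact: Ck_flat.
Qed.

Lemma box_bump_ge0 a b n x : 0 <= box_bump a b n x.
Proof. by rewrite box_bumpE prodr_ge0// => i _; rewrite mulr_ge0// flat_ge0. Qed.

Lemma box_bump_le1 a b n x : box_bump a b n x <= 1.
Proof.
rewrite box_bumpE; apply: prodr_ile1 => i _.
by rewrite mulr_ge0 ?flat_ge0//= mulr_ile1// ?flat_ge0// flat_le1.
Qed.

Lemma box_bump_out a b n x : ~ box a b x -> box_bump a b n x = 0.
Proof.
move=> /existsNP[i /negP]; rewrite negb_and -!leNgt box_bumpE => h.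
apply/eqP/prodf_eq0; exists i => //; rewrite mulf_eq0; apply/orP.
by case/orP: h => h; [left|right]; apply/eqP/flat_eq0; rewrite pmulr_rle0// subr_le0.
Qed.

Lemma box_bump_cvg a b x : box_bump a b n x @[n --> \oo] --> (\1_(box a b) x : R).
Proof.
rewrite indicE; case: (boolP (x \in box a b)) => [|/negP].
  rewrite inE => h.
  under eq_fun do rewrite box_bumpE.
  have -> : ((true : bool)%:R : R) = \prod_(i < d) 1 by rewrite big1.
  apply: (@cvg_big R _ _ _ _ (@mul_continuous R)) => i _.
  rewrite -[X in _ --> X](mulr1 1).
  by have /andP[h1 h2] := h i; apply: cvgM; apply: flat_cvg1; rewrite subr_gt0.
rewrite inE => h; under eq_fun do rewrite box_bump_out//.
exact: cvg_cst.
Qed.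

Lemma test_function_box_bump (Omega : set 'rV[R]_d) a b n :
  cbox a b `<=` Omega -> test_function Omega (box_bump a b n).
Proof.
move=> abO; split; first exact: smooth_box_bump.
exists (cbox a b); split=> // [|x nx]; first exact: compact_cbox.
apply: box_bump_out; apply: contra_not nx => h i.
by have /andP[h1 h2] := h i; rewrite !ltW.
Qed.
End smoothness.

(** * Square-integrable functions and the du Bois-Reymond lemma *)

Section L2_facts.
Context {R : realType} {d : nat}.
Implicit Types (Omega : set 'rV[R]_d) (f g : 'rV[R]_d -> R).
Local Notation leb := (lebesgue_rV R d).

Lemma L2_sqr_integrable Omega f : L2 Omega f ->
  leb.-integrable Omega (EFin \o (fun x => f x ^+ 2)).
Proof.
move=> [mf hf]; apply/integrableP; split.
  by apply/measurable_EFinP; exact: measurable_funX.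
by under eq_integral do rewrite /= ger0_norm ?sqr_ge0//.
Qed.

Lemma L2_integrableM Omega f g : measurable Omega -> L2 Omega f -> L2 Omega g ->
  leb.-integrable Omega (EFin \o (fun x => f x * g x)).
Proof.
move=> mO Lf Lg.
apply: (le_integrable mO _ _ (integrableD mO (L2_sqr_integrable Lf) (L2_sqr_integrable Lg))).
  apply/measurable_EFinP; apply: measurable_funM; [by case: Lf|by case: Lg].
move=> x _ /=; rewrite lee_fin [leRHS]ger0_norm ?addr_ge0 ?sqr_ge0// normrM.
rewrite -[f x ^+ 2]real_normK ?num_real// -[g x ^+ 2]real_normK ?num_real//.
have := sqr_ge0 (`|f x| - `|g x|); have := normr_ge0 (f x); have := normr_ge0 (g x); nra.
Qed.

Lemma L2_lin Omega f g (a b : R) : measurable Omega -> L2 Omega f -> L2 Omega g ->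
  L2 Omega (fun x => a * f x + b * g x).
Proof.
move=> mO Lf Lg; have [mf _] := Lf; have [mg _] := Lg; split.
  by apply: measurable_funD; apply: measurable_funM => //; exact: measurable_cst.
have i2 := integrableD mO
  (integrableD mO (integrableZl mO (a ^+ 2) (L2_sqr_integrable Lf))
     (integrableZl mO (b ^+ 2) (L2_sqr_integrable Lg)))
  (integrableZl mO (2 * a * b) (L2_integrableM mO Lf Lg)).
have /integrableP[_] := i2; apply: le_lt_trans; apply: ge0_le_integral => //.
- by move=> x _; rewrite lee_fin sqr_ge0.
- apply/measurable_EFinP; apply: measurable_funX.
  by apply: measurable_funD; apply: measurable_funM => //; exact: measurable_cst.
- by apply: measurableT_comp => //; exact: measurable_int i2.
- move=> x _ /=; rewrite lee_fin; apply: le_trans (ler_norm _).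
  by rewrite le_eqVlt; apply/orP; left; apply/eqP; ring.
Qed.

Lemma L2Z Omega f (a : R) : measurable Omega -> L2 Omega f ->
  L2 Omega (fun x => a * f x).
Proof.
move=> mO Lf; have := L2_lin a 0 mO Lf Lf.
by under eq_fun do rewrite mul0r addr0.
Qed.

Lemma L2_indic Omega (A : set 'rV[R]_d) : measurable Omega -> measurable A ->
  (leb A < +oo)%E -> L2 Omega \1_A.
Proof.
move=> mO mA Aoo; split; first exact: measurable_indic.
under eq_integral do rewrite indicE expr2 -natrM mulnb andbb.
rewrite integral_indic//; apply: le_lt_trans Aoo.
by apply: le_measure; rewrite ?inE//; exact: measurableI.
Qed.

Lemma L2_bounded_indic Omega f (A : set 'rV[R]_d) (M : R) : measurable Omega ->
  measurable A -> (leb A < +oo)%E -> measurable_fun Omega f ->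
  (forall x, `|f x| <= M * \1_A x) -> L2 Omega f.
Proof.
move=> mO mA Aoo mf fM; split => //.
have [m1] := L2Z M mO (L2_indic mO mA Aoo); apply: le_lt_trans.
apply: ge0_le_integral => //.
- by move=> x _; rewrite lee_fin sqr_ge0.
- by apply/measurable_EFinP; exact: measurable_funX.
- by apply/measurable_EFinP; exact: measurable_funX.
- move=> x _; rewrite lee_fin -[f x ^+ 2]real_normK ?num_real//.
  by apply: lerXn2r => //; rewrite nnegrE// (le_trans _ (fM x)).
Qed.

Lemma L2_compact_support Omega h (K : set 'rV[R]_d) : measurable Omega ->
  continuous h -> compact K -> (forall x, ~ K x -> h x = 0) -> L2 Omega h.
Proof.
move=> mO ch cK h0.
have /compact_bounded[M [_ hM]] : compact (h @` K).
  by apply: continuous_compact => //; exact: continuous_subspaceT.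
apply: (@L2_bounded_indic _ _ K (M + 1)) => //.
- by apply: closed_measurable_rV; apply: compact_closed => //; exact: norm_hausdorff.
- exact: lebesgue_rV_compact.
- by apply: measurable_funTS; exact: continuous_measurable_rV.
- move=> x; rewrite indicE; case: (boolP (x \in K)) => [|/negP]; rewrite inE => Kx.
    rewrite mulr1; apply: (hM (M + 1)); first by rewrite ltrDl.
    by exists x.
  by rewrite h0// normr0 mulr0.
Qed.

Lemma partial_out (K : set 'rV[R]_d) f j : closed K ->
  (forall x, ~ K x -> f x = 0) -> forall x, ~ K x -> partial j f x = 0.
Proof.
move=> cK f0 x nKx; rewrite /partial.
have e : \forall y \near x, f y = cst 0 y.
  have : nbhs x (~` K) by apply: open_nbhs_nbhs; split => //; exact: closed_openC.
  by apply: filterS => y; exact: f0.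
by rewrite (@near_eq_derive _ _ _ f (cst 0) _ _ e) derive_cst.
Qed.

Lemma L2_test Omega phi : measurable Omega -> test_function Omega phi -> L2 Omega phi.
Proof.
move=> mO [/smooth_continuous cphi [K [cK _ K0]]].
exact: (L2_compact_support mO cphi cK).
Qed.

Lemma L2_partial_test Omega phi j : measurable Omega -> test_function Omega phi ->
  L2 Omega (partial j phi).
Proof.
move=> mO [sphi [K [cK _ K0]]].
apply: (L2_compact_support mO _ cK).
  by apply: smooth_continuous; exact: smooth_partial.
apply: partial_out => //; apply: compact_closed => //; exact: norm_hausdorff.
Qed.

(** The real-valued integral is the finite part of the extended one and would also be 0 for an
    infinite value; integrability excludes this. *)
Lemma integrable_Rintegral0 Omega f : measurable Omega -> leb.-integrable Omega (EFin \o f) ->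
  (\int[leb]_(x in Omega) f x)%R = 0 -> (\int[leb]_(x in Omega) (f x)%:E = 0)%E.
Proof.
move=> mO fi h; rewrite -[LHS]fineK; last exact: integrable_fin_num.
exact: (congr1 EFin h).
Qed.

Section du_Bois_Reymond.
Variables (Omega : set 'rV[R]_d) (f : 'rV[R]_d -> R).
Hypotheses (oO : open Omega) (Lf : L2 Omega f).
Hypothesis f_test : forall phi, test_function Omega phi ->
  (\int[leb]_(x in Omega) (f x * phi x))%R = 0.

Let mO : measurable Omega := open_measurable_rV oO.

(** The bumps of the box are test functions that tend to its indicator; dominated convergence
    applies with |f| on the box as majorant. *)
Lemma integral_box0 a b : cbox a b `<=` Omega ->
  (\int[leb]_(x in box a b) (f x)%:E = 0)%E.
Proof.
move=> abO; have mb := measurable_box a b.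
have Lb : L2 Omega \1_(box a b).
  by apply: L2_indic => //; rewrite lebesgue_rV_box ltry.
have mf : measurable_fun Omega f by case: Lf.
have := @dominated_convergence _ _ _ leb Omega mO (fun n x => (f x * box_bump a b n x)%:E)
  (fun x => (f x * \1_(box a b) x)%:E) (fun x => `|(f x * \1_(box a b) x)%:E|%E).
case.
- move=> n; apply/measurable_EFinP; apply: measurable_funM => //.
  apply: measurable_funTS; apply: continuous_measurable_rV.
  by apply: smooth_continuous; exact: smooth_box_bump.
- apply/measurable_EFinP; apply: measurable_funM => //; exact: measurable_indic.
- apply/aeW => x _; apply: cvg_EFin; first exact: nearW.
  by apply: cvgMr; exact: box_bump_cvg.
- by apply: integrable_abse; exact: (L2_integrableM mO Lf Lb).
- apply/aeW => x n _; rewrite lee_fin !normrM ler_wpM2l// indicE.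
  case: (boolP (x \in box a b)) => [_|/negP]; last first.
    by rewrite inE => h; rewrite box_bump_out.
  by rewrite normr1 ger0_norm ?box_bump_ge0// box_bump_le1.
move=> _ _.
have -> : (fun n => \int[leb]_(x in Omega) (f x * box_bump a b n x)%:E)%E = (fun=> 0%E).
  apply/funext => n; apply: integrable_Rintegral0 => //; last exact/f_test/test_function_box_bump.
  apply: L2_integrableM => //; apply: L2_test => //; exact: test_function_box_bump.
move=> /(cvg_unique _ (cvg_cst _)) => /(_ (@ereal_hausdorff _)) h.
rewrite [RHS]h.
under [in RHS]eq_integral do rewrite EFinM.
have e : Omega `&` box a b = box a b.
  apply/setIidr => x xab; apply: abO => i.
  by have /andP[h1 h2] := xab i; rewrite !ltW.
by rewrite -[in LHS]e integral_mkcondr; apply: eq_integral => x _; rewrite epatch_indic.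
Qed.

Lemma boxI a b a' b' : box a b `&` box a' b' =
  box (\row_i Num.max (a 0 i) (a' 0 i)) (\row_i Num.min (b 0 i) (b' 0 i)) :> set 'rV[R]_d.
Proof.
apply/seteqP; split=> x.
  move=> [h1 h2] i; have := h1 i; have := h2 i; rewrite !mxE gt_max lt_min.
  by move=> /andP[-> ->] /andP[-> ->].
move=> h; split=> i; have := h i; rewrite !mxE gt_max lt_min;
  by move=> /andP[/andP[? ?] /andP[? ?]]; apply/andP.
Qed.

(** The sets whose intersection with the box carries zero integral of [f] form a Dynkin class. It
    contains all boxes, hence all measurable sets, and a function with zero integral over every
    measurable subset vanishes almost everywhere. *)
Lemma ae_box0 a b : cbox a b `<=` Omega ->
  ae_eq leb (box a b) (EFin \o f) (cst 0%E).
Proof.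
move=> abO; have mb := measurable_box a b.
have bO : box a b `<=` Omega.
  by move=> x xab; apply: abO => i; have /andP[h1 h2] := xab i; rewrite !ltW.
have fi : leb.-integrable (box a b) (EFin \o f).
  have L1 : L2 (box a b) (fun x => \1_(box a b) x).
    by apply: L2_indic => //; rewrite lebesgue_rV_box ltry.
  have L2f : L2 (box a b) f.
    have [mf fo] := Lf; split; first exact: measurable_funS mf.
    apply: le_lt_trans fo; apply: ge0_subset_integral => //.
      by apply/measurable_EFinP; exact: measurable_funX.
    by move=> x _; rewrite lee_fin sqr_ge0.
  have := L2_integrableM mb L2f L1; apply: eq_integrable => // x; rewrite inE => xb /=.
  by rewrite indicE mem_set// mulr1.
suff H A : measurable A -> (\int[leb]_(x in box a b `&` A) (f x)%:E = 0)%E.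
  apply: integral_ae_eq => // E Eb mE.
  by rewrite integral_cst// mul0e -[E](setIidr Eb); exact: H.
rewrite measurable_rV_gen_box.
apply: (dynkin_induction (P := fun A => (\int[leb]_(x in box a b `&` A) (f x)%:E = 0)%E)) => //.
- exact: measurable_rV_gen_box.
- by move=> _ _ [a1 [b1 ->]] [a2 [b2 ->]]; rewrite boxI; eexists; eexists.
- by rewrite setIT; exact: integral_box0.
- move=> _ [a' [b' ->]]; rewrite boxI; apply: integral_box0 => x h; apply: abO => i.
  have := h i; rewrite !mxE ge_max le_min.
  by move=> /andP[/andP[-> _] /andP[-> _]].
- move=> S mS hS.
  have fm : measurable_fun (box a b) (EFin \o f) := measurable_int _ fi.
  have := integral_box0 abO; rewrite -{1}(setUIDK (box a b) S) integral_setU.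
  - by rewrite hS add0e setDE.
  - exact: measurableI.
  - exact: measurableD.
  - by rewrite setUIDK.
  - by apply/disj_setPS => x [[_ ?] [_ +]].
- move=> F mF tF hF; rewrite setI_bigcupr integral_bigcup.
  + by apply: eseries0 => n _ _; exact: hF.
  + by apply/trivIset_setIl.
  + by move=> k; exact: measurableI.
  + rewrite -setI_bigcupr; apply: integrableS fi => //; apply: measurableI => //.
    exact: bigcupT_measurable.
Qed.

(** [Omega] is a countable union of boxes to which [ae_box0] applies, and a countable union of null
    sets is null. *)
Lemma du_Bois_Reymond : ae_eq leb Omega f (cst 0).
Proof.
rewrite (open_bigcup_box oO).
set D := [set k | _].
have : leb.-negligible (\bigcup_k ~` [set x | D k -> box (rat_box d k).1 (rat_box d k).2 x -> f x = 0]).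
  apply: negligible_bigcup => k.
  have [Dk|nDk] := pselect (D k); last first.
    suff -> : [set x | D k -> box (rat_box d k).1 (rat_box d k).2 x -> f x = 0] = setT by rewrite setCT; exact: negligible_set0.
    by apply/seteqP; split=> x // _ /= /nDk.
  have := ae_box0 Dk; apply: negligibleS => x /=; apply: contra_not.
  by move=> h _ /h[].
apply: negligibleS => x /= /not_implyP[[k Dk xk] fx].
by exists k => //= /(_ Dk xk).
Qed.

End du_Bois_Reymond.
End L2_facts.

(** * Weak derivatives and traces *)

Section weak_derivative.
Context {R : realType} {d : nat}.
Implicit Types (Omega : set 'rV[R]_d) (f g : 'rV[R]_d -> R).
Local Notation leb := (lebesgue_rV R d).

Lemma weak_partial_unique Omega j f g1 g2 : open Omega ->
  L2 Omega g1 -> L2 Omega g2 ->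
  is_weak_partial Omega j f g1 -> is_weak_partial Omega j f g2 ->
  ae_eq leb Omega g1 g2.
Proof.
move=> oO L1 L2' w1 w2; have mO := open_measurable_rV oO.
have Ld := L2_lin 1 (-1) mO L1 L2'.
have := @du_Bois_Reymond _ _ Omega _ oO Ld.
have h phi : test_function Omega phi ->
    \int[leb]_(x in Omega) ((1 * g1 x + -1 * g2 x) * phi x) = 0.
  move=> tphi; have Lphi := L2_test mO tphi.
  transitivity (\int[leb]_(x in Omega) (g1 x * phi x - g2 x * phi x)).
    by apply: eq_Rintegral => x _; ring.
  rewrite RintegralB//; [|exact: L2_integrableM|exact: L2_integrableM].
  have /eqP := w2 _ tphi; rewrite (w1 _ tphi) eqr_opp => /eqP ->.
  by rewrite subrr.
move=> /(_ h); apply: filterS => x /[apply] /=.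
by rewrite mul1r mulN1r => /subr0_eq.
Qed.

Lemma is_weak_partial_weak_partial Omega j f : H1 Omega f ->
  L2 Omega (weak_partial Omega j f) /\
  is_weak_partial Omega j f (weak_partial Omega j f).
Proof.
move=> [_ /(_ j)[g Lg wg]].
exact: (@getPex _ [set g | L2 Omega g /\ is_weak_partial Omega j f g] (ex_intro _ g (conj Lg wg))).
Qed.

Lemma is_weak_partialZ Omega j f g (c : R) : measurable Omega ->
  L2 Omega f -> L2 Omega g -> is_weak_partial Omega j f g ->
  is_weak_partial Omega j (fun x => c * f x) (fun x => c * g x).
Proof.
move=> mO Lf Lg w phi tphi.
under eq_Rintegral do rewrite -mulrA.
under [in RHS]eq_Rintegral do rewrite -mulrA.
rewrite !RintegralZl//; first by rewrite w// mulrN.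
  by apply: L2_integrableM => //; exact: L2_test.
by apply: L2_integrableM => //; exact: L2_partial_test.
Qed.

Lemma H1Z Omega f (c : R) : measurable Omega -> H1 Omega f ->
  H1 Omega (fun x => c * f x).
Proof.
move=> mO [Lf hf]; split=> [|j]; first exact: L2Z.
have [g Lg wg] := hf j; exists (fun x => c * g x); first exact: L2Z.
exact: is_weak_partialZ.
Qed.

(** The representatives chosen for [f] and for [c * f] are independent choices, so homogeneity is
    obtained almost everywhere, through uniqueness. *)
Lemma weak_partialZ Omega j f (c : R) : open Omega -> H1 Omega f ->
  ae_eq leb Omega (weak_partial Omega j (fun x => c * f x))
    (fun x => c * weak_partial Omega j f x).
Proof.
move=> oO hf; have mO := open_measurable_rV oO.
have [L1 w1] := is_weak_partial_weak_partial j hf.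
have [L2' w2] := is_weak_partial_weak_partial j (H1Z c mO hf).
apply: (weak_partial_unique oO L2' _ w2); first exact: L2Z.
by apply: is_weak_partialZ => //; case: hf.
Qed.

End weak_derivative.

Section traces.
Context {R : realType} {d : nat}.
Implicit Types (Omega : set 'rV[R]_d) (f g : 'rV[R]_d -> R).
Local Notation leb := (lebesgue_rV R d).

Lemma measurable_unit_simplex n : measurable (@unit_simplex R n).
Proof.
have -> : @unit_simplex R n =
    (\bigcap_j ((fun u : 'rV[R]_n => u 0 j) @^-1` `[0, +oo[%classic)) `&`
    ((fun u : 'rV[R]_n => \sum_j u 0 j) @^-1` `]-oo, 1]%classic).
  apply/seteqP; split => u /=; rewrite /unit_simplex/= in_itv/=.
    by move=> [h1 h2]; split => // j _ /=; rewrite in_itv/= h1.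
  by move=> [h1 h2]; split => // j; have := h1 j Logic.I; rewrite /= in_itv/= andbT.
apply: measurableI.
  apply: fin_bigcap_measurable => // j _.
  by rewrite -[X in measurable X]setTI; exact: measurable_coord.
rewrite -[X in measurable X]setTI.
have : measurable_fun setT (fun u : 'rV[R]_n => \sum_j u 0 j).
  by apply: measurable_sum => j; exact: measurable_coord.
by apply.
Qed.

Lemma measurable_facet_param (p : 'I_d.+1 -> 'rV[R]_d) i :
  measurable_fun setT (facet_param p i).
Proof.
apply/measurable_fun_rVP => k; rewrite /facet_param.
under eq_fun do rewrite !mxE.
apply: measurable_funD; first exact: measurable_cst.
apply: measurable_sum => l; apply: measurable_funM; last exact: measurable_cst.
exact: measurable_coord.
Qed.

(** Nonnegativity lets the constant pass through extended-real sums and integrals that may be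
    infinite. *)
Lemma surface_integralZ m (T : 'I_m -> 'I_d.+1 -> 'rV[R]_d) (A : set 'rV[R]_d)
    f (k : R) : measurable A -> measurable_fun setT f -> (forall x, 0 <= f x) ->
  0 <= k -> surface_integral T A (fun x => k * f x) =
            (k%:E * surface_integral T A f)%E.
Proof.
move=> mA mf f0 k0; rewrite /surface_integral.
have i0 (l : 'I_m) (i : 'I_d.+1) : (0 <= \int[lebesgue_rV R d.-1]_(u in @unit_simplex R d.-1 `&`
    (facet_param (T l) i @^-1` A)) (f (facet_param (T l) i u))%:E)%E.
  by apply: integral_ge0 => u _; rewrite lee_fin.
rewrite ge0_sume_distrr; last first.
  by move=> l _; apply: sume_ge0 => i _; rewrite mule_ge0// lee_fin sqrtr_ge0.
apply: eq_bigr => l _; rewrite ge0_sume_distrr; last first.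
  by move=> i _; rewrite mule_ge0// lee_fin sqrtr_ge0.
apply: eq_bigr => i _; rewrite muleCA; congr (_ * _)%E.
under eq_integral do rewrite EFinM.
rewrite ge0_integralZl//.
- apply: measurableI; first exact: measurable_unit_simplex.
  by rewrite -[X in measurable X]setTI; exact: measurable_facet_param.
- apply/measurable_EFinP; apply: measurable_funTS.
  by apply: measurableT_comp => //; exact: measurable_facet_param.
- by move=> u _; rewrite lee_fin.
Qed.

Lemma measurable_bdry Omega : measurable (bdry Omega).
Proof.
apply: measurableD; first by apply: closed_measurable_rV; exact: closed_closure.
by apply: open_measurable_rV; exact: open_interior.
Qed.

Lemma integral_sqr_diffZ Omega f g (c : R) : measurable Omega ->
  measurable_fun Omega f -> measurable_fun Omega g ->
  (\int[leb]_(x in Omega) ((c * f x - c * g x) ^+ 2)%:E =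
   (c ^+ 2)%:E * \int[leb]_(x in Omega) ((f x - g x) ^+ 2)%:E)%E.
Proof.
move=> mO mf mg.
under eq_integral do rewrite -mulrBr exprMn EFinM.
rewrite ge0_integralZl//.
- by apply/measurable_EFinP; apply: measurable_funX; exact: measurable_funB.
- by move=> x _; rewrite lee_fin sqr_ge0.
- by rewrite lee_fin sqr_ge0.
Qed.

(** The approximating sequence is scaled along, which multiplies each of the three squared errors by
    c^2. *)
Lemma is_traceZ m (T : 'I_m -> 'I_d.+1 -> 'rV[R]_d) Omega f g (c : R) :
  open Omega -> H1 Omega f -> is_trace T Omega f g ->
  is_trace T Omega (fun x => c * f x) (fun x => c * g x).
Proof.
move=> oO hf [mg [phi [sphi phif dphi phig]]].
have mO := open_measurable_rV oO.
have mphi n : measurable_fun setT (phi n).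
  exact: (continuous_measurable_rV (smooth_continuous (sphi n))).
have c0 (u : nat -> \bar R) : u n @[n --> \oo] --> 0%E ->
    ((c ^+ 2)%:E * u n)%E @[n --> \oo] --> 0%E.
  by move=> /(cvgeZl (y := (c ^+ 2)%:E) isT); rewrite mule0.
split; first exact: measurable_funM.
exists (fun n x => c * phi n x); split.
- by move=> n; exact: smooth_scale.
- rewrite [X in X @ _ --> _](_ : _ = fun n => ((c ^+ 2)%:E *
    \int[leb]_(x in Omega) ((phi n x - f x) ^+ 2)%:E)%E); first exact: c0.
  apply/funext => n; apply: integral_sqr_diffZ => //; last by case: hf => -[].
  exact: measurable_funTS.
- move=> j; have [Lw _] := is_weak_partial_weak_partial j hf.
  have [Lw' _] := is_weak_partial_weak_partial j (H1Z c mO hf).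
  have mp n : measurable_fun Omega (partial j (phi n)).
    apply: measurable_funTS.
    exact: (continuous_measurable_rV (smooth_continuous (smooth_partial j (sphi n)))).
  rewrite [X in X @ _ --> _](_ : _ = fun n => ((c ^+ 2)%:E * \int[leb]_(x in Omega)
    ((partial j (phi n) x - weak_partial Omega j f x) ^+ 2)%:E)%E); first exact: c0.
  apply/funext => n; rewrite -integral_sqr_diffZ//; last by case: Lw.
  apply: ae_eq_integral => //.
  + apply/measurable_EFinP; apply: measurable_funX; apply: measurable_funB; last by case: Lw'.
    by rewrite (_ : partial j (fun x => c * phi n x) = fun x => c * partial j (phi n) x); [exact: measurable_funM|apply/funext => x; exact: partial_scale].
  + apply/measurable_EFinP; apply: measurable_funX; apply: measurable_funB; apply: measurable_funM => //.
    by case: Lw.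
  + apply: filterS (weak_partialZ j c oO hf) => x /[apply] ->.
    by rewrite partial_scale.
- rewrite [X in X @ _ --> _](_ : _ = fun n => ((c ^+ 2)%:E *
    surface_integral T (bdry Omega) (fun x => (phi n x - g x) ^+ 2)%R)%E); first exact: c0.
  apply/funext => n; rewrite -surface_integralZ//.
  + by congr surface_integral; apply/funext => x; ring.
  + exact: measurable_bdry.
  + by apply: measurable_funX; exact: measurable_funB.
  + by move=> x; exact: sqr_ge0.
  + exact: sqr_ge0.
Qed.

Lemma H1DZ m (T : 'I_m -> 'I_d.+1 -> 'rV[R]_d) Omega GammaD v (c : R) :
  open Omega -> measurable GammaD -> H1D T Omega GammaD v ->
  H1D T Omega GammaD (fun x => c *: v x).
Proof.
move=> oO mD hv i; have [h1 [g tg g0]] := hv i.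
have -> : (fun x => (c *: v x) 0 i) = (fun x => c * v x 0 i).
  by apply/funext => x; rewrite mxE.
split; first by apply: H1Z => //; exact: open_measurable_rV.
exists (fun x => c * g x); first exact: is_traceZ.
have [mg _] := tg.
under eq_fun do rewrite exprMn.
rewrite surface_integralZ ?g0 ?mule0//; [|by move=> x; exact: sqr_ge0|exact: sqr_ge0].
exact: measurable_funX.
Qed.

End traces.

(** * The energy inner product *)

Section frobenius.
Context {R : realType} {d : nat}.
Implicit Types (s t g : 'M[R]_d) (mu lambda : R).

Definition dot s t : R := \sum_i \sum_j s i j * t i j.

Lemma dotC s t : dot s t = dot t s.
Proof. by apply: eq_bigr => i _; apply: eq_bigr => j _; rewrite mulrC. Qed.

Lemma dotDl s s' t : dot (s + s') t = dot s t + dot s' t.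
Proof.
rewrite /dot -big_split; apply: eq_bigr => i _; rewrite -big_split.
by apply: eq_bigr => j _; rewrite mxE mulrDl.
Qed.

Lemma dotZl a s t : dot (a *: s) t = a * dot s t.
Proof.
rewrite /dot mulr_sumr; apply: eq_bigr => i _; rewrite mulr_sumr.
by apply: eq_bigr => j _; rewrite mxE mulrA.
Qed.

Lemma dotNl s t : dot (- s) t = - dot s t.
Proof. by rewrite -scaleN1r dotZl mulN1r. Qed.

Lemma dotDr s t t' : dot s (t + t') = dot s t + dot s t'.
Proof. by rewrite dotC dotDl !(dotC s). Qed.

Lemma dotZr a s t : dot s (a *: t) = a * dot s t.
Proof. by rewrite dotC dotZl dotC. Qed.

Lemma dotNr s t : dot s (- t) = - dot s t.
Proof. by rewrite dotC dotNl dotC. Qed.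

Lemma dot_scalar_mxl a t : dot a%:M t = a * \tr t.
Proof.
rewrite -scalemx1 dotZl; congr (_ * _); apply: eq_bigr => i _.
rewrite (bigD1 i)//= mxE eqxx mul1r big1 ?addr0// => j ji.
by rewrite mxE eq_sym (negbTE ji) mul0r.
Qed.

Lemma dot_ge0 s : 0 <= dot s s.
Proof. by apply: sumr_ge0 => i _; apply: sumr_ge0 => j _; rewrite -expr2 sqr_ge0. Qed.

Lemma dot_tr s t : dot s^T t^T = dot s t.
Proof.
rewrite /dot exchange_big; apply: eq_bigr => i _; apply: eq_bigr => j _.
by rewrite !mxE.
Qed.

Lemma complianceD mu lambda s t :
  compliance mu lambda (s + t) = compliance mu lambda s + compliance mu lambda t.
Proof.
by apply/matrixP => i j; rewrite /compliance mxtraceD !mxE; case: (i == j); rewrite ?mulr1n ?mulr0n; ring.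
Qed.

Lemma complianceZ mu lambda a s :
  compliance mu lambda (a *: s) = a *: compliance mu lambda s.
Proof.
by apply/matrixP => i j; rewrite /compliance mxtraceZ !mxE; case: (i == j); rewrite ?mulr1n ?mulr0n; ring.
Qed.

Lemma elasticityZ mu lambda a s :
  elasticity mu lambda (a *: s) = a *: elasticity mu lambda s.
Proof.
by apply/matrixP => i j; rewrite /elasticity mxtraceZ !mxE; case: (i == j); rewrite ?mulr1n ?mulr0n; ring.
Qed.

Lemma dot_compliance mu lambda s t :
  dot (compliance mu lambda s) t = dot s (compliance mu lambda t).
Proof.
rewrite /compliance dotZl dotZr dotDl dotDr dotNl dotNr (dotC s _%:M).
by rewrite !dot_scalar_mxl; ring.
Qed.

Section positive.
Variables mu lambda : R.
Hypotheses (hmu : 0 < mu) (hlambda : 0 <= lambda).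

Let den : 2 * mu + d%:R * lambda != 0.
Proof. by rewrite gt_eqF// ltr_pwDl ?mulr_gt0// mulr_ge0. Qed.

Lemma elasticityK s : compliance mu lambda (elasticity mu lambda s) = s.
Proof.
rewrite /compliance /elasticity mxtraceD mxtraceZ mxtrace_scalar.
rewrite [X in _ *: (_ - X%:M)](_ : _ = lambda * \tr s); last first.
  by rewrite -[_ *+ d]mulr_natr; field.
by rewrite addrK scalerA mulVf ?scale1r// mulf_neq0// gt_eqF.
Qed.

Lemma complianceK s : elasticity mu lambda (compliance mu lambda s) = s.
Proof.
rewrite /compliance /elasticity mxtraceZ -scaleN1r mxtraceD mxtraceZ mxtrace_scalar scalerA scaleN1r.
rewrite mulfV ?scale1r; last by rewrite mulf_neq0// gt_eqF.
rewrite [X in _ + X%:M](_ : _ = lambda / (2 * mu + d%:R * lambda) * \tr s).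
  by rewrite addrNK.
by rewrite -[_ *+ d]mulr_natr; field; rewrite den gt_eqF.
Qed.

Lemma dot_elasticity_ge0 s : 0 <= dot (elasticity mu lambda s) s.
Proof.
rewrite /elasticity dotDl dotZl dot_scalar_mxl addr_ge0//.
  by rewrite mulr_ge0 ?dot_ge0// mulr_ge0// ltW.
by rewrite -mulrA -expr2 mulr_ge0// sqr_ge0.
Qed.

(** With s = A (C s), the compliance energy of s is the elasticity energy of C s, which is visibly
    nonnegative. *)
Lemma dot_compliance_ge0 s : 0 <= dot (compliance mu lambda s) s.
Proof. by rewrite -[X in dot _ X]complianceK dotC dot_elasticity_ge0. Qed.

Lemma dot_compliance_elasticity s t :
  dot (compliance mu lambda s) (elasticity mu lambda t) = dot s t.
Proof. by rewrite dot_compliance elasticityK. Qed.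

End positive.

(** All cross terms vanish: [w] has trace 0 and is orthogonal to [e]. The difference [w - e] is the
    form in which the gap appears. *)
Lemma dot_elasticity_sym_skw mu lambda e w : e^T = e -> w^T = - w ->
  dot (elasticity mu lambda e) e + dot (elasticity mu lambda w) w =
  dot (elasticity mu lambda (w - e)) (w - e).
Proof.
move=> he hw.
have trw : \tr w = 0.
  have : \tr w = - \tr w by rewrite -{1}mxtrace_tr hw raddfN.
  lra.
have ew : dot e w = 0.
  have : dot e w = - dot e w by rewrite -{1}dot_tr he hw dotNr.
  lra.
rewrite /elasticity !dotDl !dotZl !dot_scalar_mxl !dotDr !dotNr !dotDl !dotNl.
rewrite !raddfD/= !raddfN/= trw (dotC w e) ew; ring.
Qed.

End frobenius.

Section inner_product.
Context {R : realType} {d : nat}.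
Variable Omega : set 'rV[R]_d.
Hypothesis mO : measurable Omega.
Implicit Types s t g : 'rV[R]_d -> 'M[R]_d.
Local Notation leb := (lebesgue_rV R d).

Lemma innerE s t : inner Omega s t = \int[leb]_(x in Omega) dot (s x) (t x).
Proof. by []. Qed.

Lemma integrable_dot s t : L2_tensor Omega s -> L2_tensor Omega t ->
  leb.-integrable Omega (EFin \o (fun x => dot (s x) (t x))).
Proof.
move=> Ls Lt.
have -> : EFin \o (fun x => dot (s x) (t x)) =
    (fun x => \sum_i \sum_j (s x i j * t x i j)%:E)%E.
  apply/funext => x; rewrite /= /dot -sumEFin; apply: eq_bigr => i _.
  by rewrite -sumEFin.
apply: integrable_sum => // i _; apply: integrable_sum => // j _.
exact: L2_integrableM.
Qed.

Lemma L2_tensor_lin (a b : R) s t : L2_tensor Omega s -> L2_tensor Omega t ->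
  L2_tensor Omega (fun x => a *: s x + b *: t x).
Proof.
move=> Ls Lt i j; under eq_fun do rewrite !mxE.
exact: L2_lin.
Qed.

Lemma L2_tensorZ (a : R) s : L2_tensor Omega s -> L2_tensor Omega (fun x => a *: s x).
Proof.
by move=> Ls i j; under eq_fun do rewrite !mxE; exact: L2Z.
Qed.

Lemma L2_sum (I : Type) (r : seq I) (F : I -> 'rV[R]_d -> R) :
  (forall i, L2 Omega (F i)) -> L2 Omega (fun x => \sum_(i <- r) F i x).
Proof.
move=> LF; elim: r => [|i r IH].
  under eq_fun do rewrite big_nil.
  by apply: (@L2_compact_support _ _ _ _ set0) => //; [exact: cst_continuous|exact: compact0].
under eq_fun do rewrite big_cons -[X in X + _]mul1r -[X in _ + X]mul1r.
exact: L2_lin.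
Qed.

Lemma L2_mxtrace s : L2_tensor Omega s -> L2 Omega (fun x => \tr (s x)).
Proof. by move=> Ls; apply: L2_sum => i; exact: Ls. Qed.

Lemma L2_compliance mu lambda s : L2_tensor Omega s ->
  L2_tensor Omega (compliance mu lambda \o s).
Proof.
move=> Ls i j.
have -> : (fun x => (compliance mu lambda \o s) x i j) = (fun x => (2 * mu)^-1 * s x i j +
   (- ((2 * mu)^-1 * (lambda / (2 * mu + d%:R * lambda) * (i == j)%:R))) * \tr (s x)).
  by apply/funext => x; rewrite /= !mxE -mulr_natr; ring.
by apply: L2_lin => //; exact: L2_mxtrace.
Qed.

Lemma L2_elasticity mu lambda s : L2_tensor Omega s ->
  L2_tensor Omega (elasticity mu lambda \o s).
Proof.
move=> Ls i j.
have -> : (fun x => (elasticity mu lambda \o s) x i j) =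
   (fun x => (2 * mu) * s x i j + (lambda * (i == j)%:R) * \tr (s x)).
  by apply/funext => x; rewrite /= !mxE -mulr_natr; ring.
by apply: L2_lin => //; exact: L2_mxtrace.
Qed.

Lemma innerC s t : inner Omega s t = inner Omega t s.
Proof. by apply: eq_Rintegral => x _; exact: dotC. Qed.

Lemma inner_linl (a b : R) s s' t : L2_tensor Omega s -> L2_tensor Omega s' ->
  L2_tensor Omega t ->
  inner Omega (fun x => a *: s x + b *: s' x) t =
  a * inner Omega s t + b * inner Omega s' t.
Proof.
move=> Ls Ls' Lt; rewrite !innerE.
under eq_Rintegral do rewrite dotDl !dotZl.
have i1 := integrable_dot Ls Lt; have i2 := integrable_dot Ls' Lt.
rewrite RintegralD//; [|exact: (integrableZl mO a i1)|exact: (integrableZl mO b i2)].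
by rewrite !RintegralZl.
Qed.

Lemma inner_linr (a b : R) s t t' : L2_tensor Omega s -> L2_tensor Omega t ->
  L2_tensor Omega t' ->
  inner Omega s (fun x => a *: t x + b *: t' x) =
  a * inner Omega s t + b * inner Omega s t'.
Proof. by move=> Ls Lt Lt'; rewrite innerC inner_linl// !(innerC _ s). Qed.

Lemma innerZr (a : R) s t : L2_tensor Omega s -> L2_tensor Omega t ->
  inner Omega s (fun x => a *: t x) = a * inner Omega s t.
Proof.
move=> Ls Lt; have := inner_linr a 0 Ls Lt Lt; rewrite mul0r addr0 => <-.
by congr inner; apply/funext => x; rewrite scale0r addr0.
Qed.

Lemma ae_eq_inner s t s' t' : L2_tensor Omega s -> L2_tensor Omega t ->
  L2_tensor Omega s' -> L2_tensor Omega t' ->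
  {ae leb, forall x, Omega x -> dot (s x) (t x) = dot (s' x) (t' x)} ->
  inner Omega s t = inner Omega s' t'.
Proof.
move=> Ls Lt Ls' Lt' h; congr fine; apply: ae_eq_integral => //.
- exact: measurable_int (integrable_dot Ls Lt).
- exact: measurable_int (integrable_dot Ls' Lt').
- by apply: filterS h => x /[apply]; rewrite /dot /= => ->.
Qed.

End inner_product.

(** * The bilinear form and the energy norm in terms of the gap *)

Section energy.
Context {R : realType} {d : nat}.
Variables (m : nat) (T : 'I_m -> 'I_d.+1 -> 'rV[R]_d) (Omega GammaD : set 'rV[R]_d).
Hypotheses (oO : open Omega) (mD : measurable GammaD).
Variables (mu lambda : R).
Hypotheses (hmu : 0 < mu) (hlambda : 0 <= lambda).
Implicit Types (s t : triple R d) (phi : 'rV[R]_d -> 'M[R]_d).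
Local Notation leb := (lebesgue_rV R d).
Local Notation C := (compliance mu lambda).
Local Notation A := (elasticity mu lambda).
Local Notation E := (energy_space T Omega GammaD).

Let mO : measurable Omega := open_measurable_rV oO.

Definition gap s (x : 'rV[R]_d) : 'M[R]_d := Defs.rot s x - weak_grad Omega (disp s) x.

Lemma L2_weak_grad s : E s -> L2_tensor Omega (weak_grad Omega (disp s)).
Proof.
move=> [_ _ hv] i j; rewrite /weak_grad; under eq_fun do rewrite mxE.
by have [hi _] := hv i; have [] := is_weak_partial_weak_partial j hi.
Qed.

Lemma L2_gap s : E s -> L2_tensor Omega (gap s).
Proof.
move=> Es; have Lw := L2_weak_grad Es; have [_ [Lr _] _] := Es.
have := L2_tensor_lin mO 1 (-1) Lr Lw.
by under eq_fun do rewrite scale1r scaleN1r.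
Qed.

Lemma Bform_gap s t : E s -> E t ->
  Bform Omega mu lambda s t = inner Omega (C \o stress s) (stress t)
    + inner Omega (stress t) (gap s) - inner Omega (stress s) (gap t).
Proof.
move=> Es Et; rewrite /Bform /bform.
have h s' t' : E s' -> E t' -> inner Omega (stress t') (Defs.rot s')
    - inner Omega (stress t') (weak_grad Omega (disp s')) = inner Omega (stress t') (gap s').
  move=> Es' Et'; have Lw := L2_weak_grad Es'; have [_ [Lr _] _] := Es'.
  have [Lt _ _] := Et'.
  have := inner_linr mO 1 (-1) Lt Lr Lw; rewrite mul1r mulN1r => <-.
  by congr inner; apply/funext => x; rewrite scale1r scaleN1r.
by rewrite !h.
Qed.

(** The strain is symmetric, the rotation defect is skew almost everywhere, and the defect minus the
    strain is the gap, so [dot_elasticity_sym_skw] applies pointwise. *)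
Lemma energy_norm_gap s : E s -> energy_norm Omega mu lambda s =
  Num.sqrt (normC2 Omega mu lambda (stress s) + normA2 Omega mu lambda (gap s)).
Proof.
move=> Es; have Lw := L2_weak_grad Es; have Lg := L2_gap Es.
have [_ [Lr skw] _] := Es.
rewrite /energy_norm -addrA; congr (Num.sqrt (_ + _)).
have LwT : L2_tensor Omega (fun x => (weak_grad Omega (disp s) x)^T).
  by move=> i j; under eq_fun do rewrite mxE; exact: Lw.
have Le : L2_tensor Omega (strain Omega (disp s)).
  have := L2_tensor_lin mO 2^-1 2^-1 Lw LwT.
  by under eq_fun do rewrite -scalerDr.
have Lo : L2_tensor Omega (fun x => Defs.rot s x - rotation Omega (disp s) x).
  have := L2_tensor_lin mO 1 (-1) Lr (L2_tensor_lin mO 2^-1 (- 2^-1) Lw LwT).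
  by under eq_fun do rewrite scale1r scaleN1r scaleNr -scalerBr.
have LAe := L2_elasticity mO mu lambda Le.
have LAo := L2_elasticity mO mu lambda Lo.
have LAg := L2_elasticity mO mu lambda Lg.
rewrite /normA2 !innerE -RintegralD//; [|exact: integrable_dot|exact: integrable_dot].
congr fine; apply: ae_eq_integral => //.
- apply: (measurable_int _ (integrableD mO (integrable_dot mO LAe Le) (integrable_dot mO LAo Lo))).
- exact: measurable_int (integrable_dot mO LAg Lg).
apply: filterS skw => x /[apply] skwx; congr EFin => /=.
have gapE : Defs.rot s x - rotation Omega (disp s) x - strain Omega (disp s) x = gap s x.
  rewrite /gap /strain /rotation; move: (weak_grad _ _ _) => D.
  by apply/matrixP => i j; rewrite !mxE; field.
rewrite dot_elasticity_sym_skw ?gapE//.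
- by rewrite /strain linearZ/= linearD/= trmxK addrC.
- rewrite /rotation linearB/= skwx linearZ/= linearB/= trmxK.
  by move: (weak_grad _ _ _) => D; apply/matrixP => i j; rewrite !mxE; ring.
Qed.

(** The stress of an admissible triple is any square-integrable tensor, so it is left free; rotation
    and displacement are scaled together so that the gap scales with them. *)
Definition test_triple s phi (k : R) : triple R d :=
  Triple phi (fun x => k *: Defs.rot s x) (fun x => k *: disp s x).

Lemma test_triple_energy_space s phi k : E s -> L2_tensor Omega phi ->
  E (test_triple s phi k).
Proof.
move=> [_ [Lr skw] hv] Lphi; split; [exact: Lphi| |exact: (H1DZ k oO mD hv)].
split; first exact: (L2_tensorZ mO k Lr).
by apply: filterS skw => x h Ox; rewrite linearZ /= (h Ox) scalerN.
Qed.

Lemma gap_test_triple s phi k : E s ->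
  {ae leb, forall x, Omega x -> gap (test_triple s phi k) x = k *: gap s x}.
Proof.
move=> [_ _ hv].
have hw i j : {ae leb, forall x, Omega x ->
    weak_partial Omega j (fun y => (k *: disp s y) 0 i) x =
    k * weak_partial Omega j (fun y => disp s y 0 i) x}.
  have [hi _] := hv i.
  have -> : (fun y => (k *: disp s y) 0 i) = (fun y => k * disp s y 0 i).
    by apply/funext => y; rewrite mxE.
  exact: weak_partialZ.
(* One null set serves the finitely many entries of the gradient. *)
have : {ae leb, forall x (ij : 'I_d * 'I_d), Omega x ->
    weak_partial Omega ij.2 (fun y => (k *: disp s y) 0 ij.1) x =
    k * weak_partial Omega ij.2 (fun y => disp s y 0 ij.1) x}.
  by apply: (@filter_forall _ _ _ (almost_everywhere leb)) => -[i j]; exact: hw.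
apply: filterS => x h Ox; apply/matrixP => i j; rewrite /gap /=.
by rewrite !mxE (h (i, j) Ox) mulrBr.
Qed.

Lemma Bform_test_triple s phi k : E s -> L2_tensor Omega phi ->
  Bform Omega mu lambda s (test_triple s phi k) =
  inner Omega (C \o stress s) phi + inner Omega phi (gap s)
  - k * inner Omega (stress s) (gap s).
Proof.
move=> Es Lphi; have Et := test_triple_energy_space k Es Lphi.
have Lg := L2_gap Es; have [Ls _ _] := Es.
rewrite (Bform_gap Es Et); congr (_ - _); rewrite -(innerZr mO k Ls Lg).
apply: (ae_eq_inner mO Ls (L2_gap Et) Ls (L2_tensorZ mO k Lg)).
by apply: filterS (gap_test_triple phi k Es) => x h Ox; rewrite (h Ox).
Qed.

Lemma energy_norm_test_triple s phi k : E s -> L2_tensor Omega phi ->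
  energy_norm Omega mu lambda (test_triple s phi k) =
  Num.sqrt (normC2 Omega mu lambda phi + k ^+ 2 * normA2 Omega mu lambda (gap s)).
Proof.
move=> Es Lphi; have Et := test_triple_energy_space k Es Lphi.
have Lg := L2_gap Es; have Lgt := L2_gap Et.
have LA := L2_elasticity mO mu lambda Lg.
rewrite (energy_norm_gap Et); congr (Num.sqrt (_ + _)).
rewrite /normA2 expr2 -mulrA -(innerZr mO k LA Lg).
rewrite (innerC _ (A \o gap s)) -(innerZr mO k (L2_tensorZ mO k Lg) LA).
rewrite (innerC _ (fun x => k *: gap s x)).
apply: (ae_eq_inner mO (L2_elasticity mO mu lambda Lgt) Lgt (L2_tensorZ mO k LA) (L2_tensorZ mO k Lg)).
apply: filterS (gap_test_triple phi k Es) => x h Ox.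
by rewrite /= (h Ox) elasticityZ.
Qed.

Section estimates.
Variable s : triple R d.
Hypothesis Es : E s.
Let X := normC2 Omega mu lambda (stress s).
Let Y := normA2 Omega mu lambda (gap s).
Let P := inner Omega (stress s) (gap s).

Let Ls : L2_tensor Omega (stress s). Proof. by case: Es. Qed.
Let Lg : L2_tensor Omega (gap s). Proof. exact: L2_gap. Qed.
Let LC := L2_compliance mO mu lambda Ls.
Let LA := L2_elasticity mO mu lambda Lg.

(** General coefficients serve two purposes: [a = b = 1] is the test stress, and nonnegativity of
    the norm for all [a], [b] gives Cauchy-Schwarz. *)
Definition stress_comb (a b : R) (x : 'rV[R]_d) := a *: stress s x + b *: (A \o gap s) x.

Lemma L2_stress_comb a b : L2_tensor Omega (stress_comb a b).
Proof. exact: (L2_tensor_lin mO a b Ls LA). Qed.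

Lemma inner_C_A : inner Omega (C \o stress s) (A \o gap s) = P.
Proof. by apply: eq_Rintegral => x _; exact: dot_compliance_elasticity. Qed.

Lemma inner_C_stress_comb a b : inner Omega (C \o stress s) (stress_comb a b) = a * X + b * P.
Proof. by rewrite (inner_linr mO a b LC Ls LA) inner_C_A. Qed.

Lemma inner_stress_comb_gap a b : inner Omega (stress_comb a b) (gap s) = a * P + b * Y.
Proof. exact: (inner_linl mO a b Ls LA Lg). Qed.

Lemma normC2_stress_comb a b : normC2 Omega mu lambda (stress_comb a b) =
  a ^+ 2 * X + 2 * a * b * P + b ^+ 2 * Y.
Proof.
rewrite /normC2.
have -> : C \o stress_comb a b = (fun x => a *: (C \o stress s) x + b *: gap s x).
  by apply/funext => x; rewrite /= /stress_comb complianceD !complianceZ elasticityK.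
rewrite (inner_linl mO a b LC Lg (L2_stress_comb a b)).
rewrite inner_C_stress_comb (innerC _ (gap s)) inner_stress_comb_gap; ring.
Qed.

Lemma normC2_ge0 phi : 0 <= normC2 Omega mu lambda phi.
Proof. by apply: Rintegral_ge0 => x _; exact: dot_compliance_ge0. Qed.

Lemma normA2_gap_ge0 : 0 <= Y.
Proof. by apply: Rintegral_ge0 => x _; exact: dot_elasticity_ge0. Qed.

Lemma inner_gap_CS : P ^+ 2 <= X * Y.
Proof.
have X0 : 0 <= X := normC2_ge0 _; have Y0 := normA2_gap_ge0.
have h a b : 0 <= a ^+ 2 * X + 2 * a * b * P + b ^+ 2 * Y.
  by rewrite -normC2_stress_comb normC2_ge0.
have [Y00|Yn0] := eqVneq Y 0.
  rewrite Y00 mulr0; have [->|Pn0] := eqVneq P 0; first by rewrite expr0n.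
  (* If Y = 0, the quadratic form takes the value - (X + 2) P^2 here, which is negative unless P =
     0. *)
  have := h P (- (X + 1)); rewrite Y00.
  have P2 : 0 < P ^+ 2 by rewrite exprn_even_gt0.
  by nra.
have Yp : 0 < Y by rewrite lt_neqAle eq_sym Yn0.
(* Up to scaling, these coefficients minimise the form for fixed [a]. *)
have := h Y (- P).
rewrite (_ : _ + _ = Y * (X * Y - P ^+ 2)); last by ring.
by rewrite pmulr_rge0// subr_ge0.
Qed.

End estimates.

End energy.

(** * The inf-sup estimate *)

Section nonzero_stress.
Context {R : realType} {d : nat}.
Variable Omega : set 'rV[R]_d.+1.
Hypotheses (oO : open Omega) (O0 : Omega !=set0).
Variables (mu lambda : R).
Hypotheses (hmu : 0 < mu) (hlambda : 0 <= lambda).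
Local Notation leb := (lebesgue_rV R d.+1).

(** Take A I on a box inside [Omega]: since C A I = I, the energy density there is the trace of A I,
    positive because the dimension is. *)
Lemma normC2_pos_exists : exists2 phi, L2_tensor Omega phi &
  0 < normC2 Omega mu lambda phi.
Proof.
have mO := open_measurable_rV oO.
have [x Ox] := O0; move: (Ox); rewrite {1}(open_bigcup_box oO) => -[k /= kO xk].
set a := (@rat_box R d.+1 k).1 in kO xk; set b := (@rat_box R d.+1 k).2 in kO xk.
have mb := measurable_box a b.
have boo : (leb (box a b) < +oo)%E by rewrite lebesgue_rV_box ltry.
have L1 := L2_indic mO mb boo.
have bO : box a b `<=` Omega.
  by move=> y yab; apply: kO => i; have /andP[h1 h2] := yab i; rewrite !ltW.
pose M : 'M[R]_d.+1 := elasticity mu lambda 1%:M.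
exists (fun x => \1_(box a b) x *: M).
  move=> i j; have -> : (fun x => (\1_(box a b) x *: M) i j) = (fun x => M i j * \1_(box a b) x).
    by apply/funext => y; rewrite mxE mulrC.
  exact: (L2Z (M i j) mO L1).
have -> : normC2 Omega mu lambda (fun x => \1_(box a b) x *: M) =
    dot (compliance mu lambda M) M * \int[leb]_(x in Omega) \1_(box a b) x.
  rewrite -RintegralZl//.
    apply: eq_Rintegral => y _; rewrite -/(dot _ _) /= complianceZ dotZl dotZr indicE.
    by case: (y \in _); rewrite /= ?mul1r ?mulr1 ?mul0r ?mulr0.
  have := L2_integrableM mO L1 L1; apply: eq_integrable => // y _ /=.
  by rewrite indicE; case: (y \in _); rewrite ?mulr1 ?mulr0.
apply: mulr_gt0.
  rewrite elasticityK// dot_scalar_mxl mul1r /M /elasticity mxtraceD mxtraceZ.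
  rewrite !mxtrace_scalar ltr_pwDl//.
    by rewrite !mulr_gt0// ltr0n.
  by rewrite mulrn_wge0// mulr_ge0// ler0n.
have -> : \int[leb]_(x in Omega) \1_(box a b) x = fine (lebesgue_rV R d.+1 (box a b)).
  by rewrite /Rintegral integral_indic// (setIidl bO).
rewrite lebesgue_rV_box /=.
apply: prodr_gt0 => i _; rewrite lt_max subr_gt0.
by have /andP[h1 h2] := xk i; rewrite (lt_trans h1 h2) orbT.
Qed.

End nonzero_stress.

(** From c^2 = 1 - c, the difference of the two sides is c (X - k^2 Y) + ((1 + c) k^2 + 2 k + c) Y,
    and c (1 + c) = 1 makes the last bracket (1 + c) (k + c)^2. Both terms vanish for k = - c and X
    = k^2 Y, so the constant is optimal here. *)
Lemma golden_estimate (R : rcfType) (X Y k : R) : 0 <= X -> 0 <= Y ->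
  k ^+ 2 * Y <= X ->
  ((Num.sqrt 5 - 1) / 2) ^+ 2 * (X + Y) <= X + 2 * (k * Y) + Y + k ^+ 2 * Y.
Proof.
move=> X0 Y0 kX; set c := (Num.sqrt 5 - 1) / 2.
have c2 : c ^+ 2 = 1 - c.
  have h5 : Num.sqrt 5 ^+ 2 = 5 :> R by rewrite sqr_sqrtr.
  by rewrite /c exprMn sqrrB h5; field.
have c0 : 0 <= c.
  by rewrite /c divr_ge0// subr_ge0 -[leLHS]sqrtr1 ler_wsqrtr// ler1n.
have c1 : c * (1 + c) = 1 by rewrite mulrDr mulr1 -expr2 c2; ring.
rewrite -subr_ge0.
have -> : X + 2 * (k * Y) + Y + k ^+ 2 * Y - c ^+ 2 * (X + Y) =
    c * (X - k ^+ 2 * Y) + (1 + c) * (k + c) ^+ 2 * Y.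
  have -> : (1 + c) * (k + c) ^+ 2 = (1 + c) * k ^+ 2 + 2 * k + c.
    transitivity ((1 + c) * k ^+ 2 + 2 * k * (c * (1 + c)) + c * (c * (1 + c))).
      by ring.
    by rewrite c1; ring.
  by rewrite c2; ring.
apply: addr_ge0; first by rewrite mulr_ge0// subr_ge0.
apply: mulr_ge0 => //; apply: mulr_ge0; last exact: sqr_ge0.
exact: addr_ge0.
Qed.

Lemma golden_gt0 (R : rcfType) : 0 < (Num.sqrt 5 - 1) / 2 :> R.
Proof. by rewrite divr_gt0// subr_gt0 -[ltLHS]sqrtr1 ltr_sqrt// ltr1n. Qed.

Lemma golden_sqrt_estimate (R : rcfType) (X Y P : R) (k := P / Y) : 0 <= X -> 0 <= Y ->
  P ^+ 2 <= X * Y ->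
  [/\ k * Y = P, 0 <= X + 2 * P + Y + k ^+ 2 * Y &
      (Num.sqrt 5 - 1) / 2 * Num.sqrt (X + Y) <=
      Num.sqrt (X + 2 * P + Y + k ^+ 2 * Y)].
Proof.
move=> X0 Y0 CS.
have kY : k * Y = P.
  (* When Y = 0 the quotient [P / Y] is 0 by convention, and Cauchy-Schwarz gives P = 0 as well. *)
  rewrite /k; have [Y00|Yn0] := eqVneq Y 0; last by rewrite divfK.
  rewrite Y00 mulr0; apply/esym/eqP; rewrite -sqrf_eq0 eq_le sqr_ge0 andbT.
  by move: CS; rewrite Y00 mulr0.
have kX : k ^+ 2 * Y <= X.
  have [->|Yn0] := eqVneq Y 0; first by rewrite mulr0.
  have Yp : 0 < Y by rewrite lt_neqAle eq_sym Yn0.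
  by rewrite -(ler_pM2r Yp) -mulrA -expr2 -exprMn kY.
have := golden_estimate X0 Y0 kX; rewrite kY => golden.
have N0 : 0 <= X + 2 * P + Y + k ^+ 2 * Y.
  by apply: le_trans golden; rewrite mulr_ge0 ?sqr_ge0// addr_ge0.
split => //; apply: le_trans (ler_wsqrtr golden).
by rewrite sqrtrM ?sqr_ge0// sqrtr_sqr gtr0_norm// golden_gt0.
Qed.

Lemma divr_sqrtr (R : rcfType) (x : R) : 0 <= x -> x / Num.sqrt x = Num.sqrt x.
Proof.
move=> x0; have [->|h] := eqVneq (Num.sqrt x) 0; first by rewrite invr0 mulr0.
by rewrite -{1}(sqr_sqrtr x0) expr2 mulfK.
Qed.

Theorem theorem1 (R : realType) (d : nat) (hd : d = 2%N \/ d = 3%N)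
  (m : nat) (T : 'I_m -> 'I_d.+1 -> 'rV[R]_d)
  (Omega GammaD GammaN : set 'rV[R]_d)
  (hOmega : polyhedral_domain T Omega)
  (hGamma : boundary_parts T Omega GammaD GammaN)
  (mu lambda : R) (hmu : 0 < mu) (hlambda : 0 <= lambda)
  (plane_stress : bool) (hps : plane_stress -> d = 2%N) :
  let lam := lame_lambda plane_stress mu lambda in
  forall s : triple R d, energy_space T Omega GammaD s ->
    (((Num.sqrt 5 - 1) / 2 * energy_norm Omega mu lam s)%R%:E <=
     ereal_sup [set (Bform Omega mu lam s t / energy_norm Omega mu lam t)%R%:E
       | t in [set t | energy_space T Omega GammaD t /\
                       (energy_norm Omega mu lam t != 0)%R]])%E.
Proof.
move=> lam s Es.
have lam0 : 0 <= lam.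
  rewrite /lam /lame_lambda; case: plane_stress {hps lam} => //.
  by rewrite divr_ge0 ?addr_ge0 ?mulr_ge0// ltW.
have [_ _ OE O0 _] := hOmega.
have oO : open Omega by rewrite OE; exact: open_interior.
have mO := open_measurable_rV oO.
have [[mD _] _ _ _] := hGamma.
set c := (Num.sqrt 5 - 1) / 2.
have attained t : energy_space T Omega GammaD t -> energy_norm Omega mu lam t != 0 ->
    c * energy_norm Omega mu lam s <=
      Bform Omega mu lam s t / energy_norm Omega mu lam t ->
    ((c * energy_norm Omega mu lam s)%R%:E <=
     ereal_sup [set (Bform Omega mu lam s t / energy_norm Omega mu lam t)%R%:E
       | t in [set t | energy_space T Omega GammaD t /\
                       (energy_norm Omega mu lam t != 0)%R]])%E.
  move=> Et t0 h; apply: (@le_trans _ _ (Bform Omega mu lam s t / energy_norm Omega mu lam t)%:E).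
    by rewrite lee_fin.
  by apply: ereal_sup_ubound; exists t.
have [Ls _ _] := Es.
have Lg := L2_gap oO Es.
have X0 := normC2_ge0 Omega hmu lam0 (stress s).
have Y0 : 0 <= normA2 Omega mu lam (gap Omega s) := normA2_gap_ge0 Omega hmu lam0 s.
have CS := inner_gap_CS oO hmu lam0 Es.
have Ns := energy_norm_gap oO mu lam Es.
have NX := normC2_stress_comb oO hmu lam0 Es 1 1.
have B1 := inner_C_stress_comb oO hmu lam0 Es 1 1.
have B2 := inner_stress_comb_gap oO mu lam Es 1 1.
pose phi := stress_comb Omega mu lam s 1 1.
rewrite -/phi in NX B1 B2.
have Lphi : L2_tensor Omega phi := L2_stress_comb oO mu lam Es 1 1.
set X := normC2 Omega mu lam (stress s) in X0 CS Ns NX B1 B2.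
set Y := normA2 Omega mu lam (gap Omega s) in Y0 CS Ns NX B1 B2.
set P := inner Omega (stress s) (gap Omega s) in CS NX B1 B2.
have [] := golden_sqrt_estimate X0 Y0 CS.
set k := P / Y => kY N0 cN.
(* The minus sign turns the term - (tau, G_t) of the form into k P = k^2 Y, the same term as in the
   norm of t. *)
pose t := test_triple s phi (- k).
have Et : energy_space T Omega GammaD t.
  exact: (test_triple_energy_space oO mD (- k) Es Lphi).
have Nt : energy_norm Omega mu lam t = Num.sqrt (X + 2 * P + Y + k ^+ 2 * Y).
  rewrite (energy_norm_test_triple oO mD mu lam (- k) Es Lphi) NX sqrrN -/Y.
  by congr (Num.sqrt (_ + _)); ring.
have Bt : Bform Omega mu lam s t = X + 2 * P + Y + k ^+ 2 * Y.
  rewrite (Bform_test_triple oO mD mu lam (- k) Es Lphi) B1 B2 -/P -kY; ring.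
(* If t has nonzero norm, the quotient is N / sqrt N = sqrt N with N the common value of form and
   squared norm. *)
have [Nt0|/eqP Ntn0] := EM (energy_norm Omega mu lam t = 0); last first.
  by apply: (attained t Et Ntn0); rewrite Bt Nt (divr_sqrtr N0) Ns.
have cNs0 : c * energy_norm Omega mu lam s = 0.
  apply/le_anti/andP; split; first by rewrite -Nt0 Nt Ns.
  exact: mulr_ge0 (ltW (golden_gt0 R)) (sqrtr_ge0 _).
(* In the degenerate case the left-hand side is 0, so one admissible triple with a nonnegative
   quotient is enough. *)
have [psi Lpsi psi0] : exists2 phi, L2_tensor Omega phi & 0 < normC2 Omega mu lam phi.
  move: oO O0 hd; clear -hmu lam0; case: d Omega => [|n] Omega oO O0 hd.
    by case: hd.
  exact: normC2_pos_exists.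
have LC := L2_compliance mO mu lam Ls.
pose b := inner Omega (compliance mu lam \o stress s) psi + inner Omega psi (gap Omega s).
(* The form is linear in the test stress, and [b] is its value at [psi] with zero rotation and
   displacement; the sign [e] makes it nonnegative without changing the norm. *)
pose e : R := if 0 <= b then 1 else -1.
have eb0 : 0 <= e * b.
  by rewrite /e; case: ifPn => [|]; rewrite ?mul1r// -ltNge mulN1r oppr_ge0 => /ltW.
have Lepsi := L2_tensorZ mO e Lpsi.
pose t' := test_triple s (fun x => e *: psi x) 0.
have Nt' : 0 < energy_norm Omega mu lam t'.
  rewrite (energy_norm_test_triple oO mD mu lam 0 Es Lepsi) expr0n mul0r addr0 sqrtr_gt0.
  have -> : normC2 Omega mu lam (fun x => e *: psi x) = normC2 Omega mu lam psi; last by [].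
  apply: eq_Rintegral => x _; rewrite -!/(dot _ _) /= complianceZ dotZl dotZr mulrA.
  by rewrite /e; case: ifP; rewrite ?mulrNN !mul1r.
have Bt' : Bform Omega mu lam s t' = e * b.
  rewrite (Bform_test_triple oO mD mu lam 0 Es Lepsi) mul0r subr0.
  rewrite (innerZr mO e LC Lpsi) (innerC _ (fun x => e *: psi x)).
  by rewrite (innerZr mO e Lg Lpsi) (innerC _ (gap Omega s)) -mulrDr.
apply: (attained t' (test_triple_energy_space oO mD 0 Es Lepsi)).
  by rewrite gt_eqF.
rewrite cNs0 Bt'; exact: divr_ge0 eb0 (ltW Nt').
Qed.
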